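(* Let $F$ be a field of characteristic different from $2$, and let $F_0,F_1$ be intermediate fields of $F(2)/F$ such that $$G_F(2)\cong G_{F_0}(2)\ast_2 G_{F_1}(2),$$ where $G_{F_0}(2)$ is a free pro-$2$ group and $F_1$ has trivial Kaplansky radical, i.e. $R(F_1)=\dot F_1^2$. Let $K=F(\sqrt a)$, where $a\in\dot F\setminus\dot F^2$, and let $N=N_{K/F}:\dot K\longrightarrow\dot F$ be the norm map. Then $$N^{-1}(R(F))=\dot F\,R(K).$$
   Context: For a field $E$ of characteristic different from $2$: $\dot E=E\setminus\{0\}$ and $\dot E^2=\{\alpha^2\mid\alpha\in\dot E\}$. $E(2)$ is the maximal $2$-extension of $E$ (the maximal Galois extension with pro-$2$ Galois group) inside a fixed separable closure, and $G_E(2)=\operatorname{Gal}(E(2)/E)$. For an intermediate field $M$ of $E(2)/E$ one has $M(2)=E(2)$, so $G_M(2)=\operatorname{Gal}(E(2)/M)$ is a closed subgroup of $G_E(2)$. For $a\in\dot E$, $D_E\langle 1,a\rangle=\{x^2+ay^2\ne 0\mid x,y\in E\}$. The Kaplansky radical of $E$ is $R(E)=\bigcap_{a\in\dot E}D_E\langle1,a\rangle$, a subgroup of $\dot E$ containing $\dot E^2$; $E$ has trivial Kaplansky radical if $R(E)=\dot E^2$. The symbol $\ast_2$ denotes the free pro-$2$ product (coproduct in the category of pro-$2$ groups). Free pro-$2$ groups of any rank, including the trivial group (rank $0$), are allowed. *)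

(* Defs.v *)
From HB Require Import structures.
From mathcomp Require Import all_boot all_order all_algebra all_fingroup all_field.
From mathcomp Require Import boolp classical_sets functions cardinality filter.
From mathcomp Require Import topology.

Set Implicit Arguments.
Unset Strict Implicit.
Unset Printing Implicit Defensive.

Import GRing.Theory.

Local Open Scope card_scope.
Local Open Scope classical_set_scope.
Local Open Scope ring_scope.

HB.mixin Record isTopGroup G & monoid.Group G & Topological G := {
  mulg_continuous : continuous (fun xy : G * G => (xy.1 * xy.2)%g);
  invg_continuous : continuous (fun x : G => x^-1%g)
}.

#[short(type="topGroupType")]
HB.structure Definition TopGroup :=
  {G of isTopGroup G & monoid.Group G & Topological G}.

Definition continuous_hom (G H : topGroupType) (f : G -> H) : Prop :=
  {morph f : x y / (x * y)%g} /\ continuous f.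

Definition normal_subgroup (G : topGroupType) (U : set G) : Prop :=
  [/\ U 1%g, (forall x y, U x -> U y -> U (x * y^-1)%g)
    & (forall x y, U x -> U (x ^ y)%g)].

Definition pro2 (G : topGroupType) : Prop :=
  [/\ compact [set: G], hausdorff_space G, totally_disconnected [set: G]
    & forall U : set G, open U -> normal_subgroup U ->
        exists n, [set [set (x * u)%g | u in U] | x in [set: G]] #= `I_(2 ^ n)].

(* [G] is a coproduct of [G0] and [G1] in the category of pro-2 groups and
   continuous homomorphisms; coproducts being defined up to isomorphism, this
   says that [G] is isomorphic to the free pro-2 product of [G0] and [G1]. *)
Definition free_pro2_product (G0 G1 G : topGroupType) : Prop :=
  [/\ pro2 G0, pro2 G1, pro2 G
    & exists (i0 : G0 -> G) (i1 : G1 -> G),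
      [/\ continuous_hom i0, continuous_hom i1
        & forall H : topGroupType, pro2 H ->
          forall (f0 : G0 -> H) (f1 : G1 -> H),
            continuous_hom f0 -> continuous_hom f1 ->
            exists! f : G -> H,
              [/\ continuous_hom f, f \o i0 = f0 & f \o i1 = f1]]].

Definition converges_to_1 (X : Type) (G : topGroupType) (f : X -> G) : Prop :=
  forall U : set G, nbhs 1%g U -> finite_set (f @^-1` (~` U)).

(* For infinite rank, bases of free pro-2 groups converge to 1. *)
Definition free_pro2 (G : topGroupType) : Prop :=
  pro2 G /\
  exists (X : Type) (i : X -> G), converges_to_1 i /\
    forall H : topGroupType, pro2 H ->
    forall f : X -> H, converges_to_1 f ->
      exists! phi : G -> H, continuous_hom phi /\ phi \o i = f.

(* A field extension [L] of [E] is given by an embedding [j : E -> L]; an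
   intermediate field of [L / E] is a factorization of [j]. *)

Record galois_group (E L : fieldType) (j : {rmorphism E -> L}) := GaloisGroup {
  galgrp_fun :> L -> L;
  galgrp_zmod : zmod_morphism galgrp_fun;
  galgrp_monoid : monoid_morphism galgrp_fun;
  galgrp_bij : bijective galgrp_fun;
  galgrp_fix : forall x, galgrp_fun (j x) = j x
}.

Section KrullTopology.
Context {E L : fieldType} (j : {rmorphism E -> L}).
Implicit Types s t : galois_group j.

HB.instance Definition _ := gen_eqMixin (galois_group j).
HB.instance Definition _ := gen_choiceMixin (galois_group j).

Lemma galgrpP s t : s =1 t -> s = t.
Proof.
case: s t => [f f1 f2 f3 f4] [g g1 g2 g3 g4] /= /funext fg.
by subst g; congr GaloisGroup; exact: Prop_irrelevance.
Qed.

Definition galgrp_one : galois_group j.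
Proof. by refine (@GaloisGroup _ _ j id _ _ _ _) => //; exists id. Defined.

(* [(s * t) x = s (t x)] *)
Definition galgrp_mul s t : galois_group j.
Proof.
refine (@GaloisGroup _ _ j (s \o t) _ _ _ _).
- by move=> x y; rewrite /= (galgrp_zmod t) (galgrp_zmod s).
- split; first by rewrite /= (galgrp_monoid t).1 (galgrp_monoid s).1.
  by move=> x y; rewrite /= (galgrp_monoid t).2 (galgrp_monoid s).2.
- exact: bij_comp (galgrp_bij s) (galgrp_bij t).
- by move=> x; rewrite /= !galgrp_fix.
Defined.

Lemma galgrp_inv_ex s : exists t, cancel s t /\ cancel t s.
Proof.
have [g sK gK] := galgrp_bij s; have sI := can_inj sK.
unshelve eexists (@GaloisGroup _ _ j g _ _ _ _); last by [].
- by move=> x y; apply: sI; rewrite galgrp_zmod !gK.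
- split; first by apply: sI; rewrite (galgrp_monoid s).1 gK.
  by move=> x y; apply: sI; rewrite (galgrp_monoid s).2 !gK.
- by exists s.
- by move=> x; apply: sI; rewrite gK galgrp_fix.
Qed.

Definition galgrp_inv s : galois_group j := projT1 (cid (galgrp_inv_ex s)).

Lemma galgrp_invK s : cancel s (galgrp_inv s) /\ cancel (galgrp_inv s) s.
Proof. exact: projT2 (cid (galgrp_inv_ex s)). Qed.

Fact galgrp_mulA : associative galgrp_mul. Proof. by move=> s t u; apply: galgrpP. Qed.
Fact galgrp_mul1 : left_id galgrp_one galgrp_mul. Proof. by move=> s; apply: galgrpP. Qed.
Fact galgrp_1mul : right_id galgrp_one galgrp_mul. Proof. by move=> s; apply: galgrpP. Qed.
Fact galgrp_mulV : left_inverse galgrp_one galgrp_inv galgrp_mul.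
Proof. by move=> s; apply: galgrpP => x; exact: (galgrp_invK s).1. Qed.
Fact galgrp_Vmul : right_inverse galgrp_one galgrp_inv galgrp_mul.
Proof. by move=> s; apply: galgrpP => x; exact: (galgrp_invK s).2. Qed.

HB.instance Definition _ :=
  isGroup.Build (galois_group j) galgrp_mulA galgrp_mul1 galgrp_1mul galgrp_mulV galgrp_Vmul.

(* The Krull topology: the automorphisms that agree with [s] on a finite set [A]
   form the coset of [s] modulo Gal(L / E(A)). *)
Definition galgrp_open (U : set (galois_group j)) : Prop :=
  forall s, U s -> exists A : seq L, forall t, {in A, s =1 t} -> U t.

Fact galgrp_openT : galgrp_open setT. Proof. by move=> s _; exists [::]. Qed.

Fact galgrp_openI U V : galgrp_open U -> galgrp_open V -> galgrp_open (U `&` V).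
Proof.
move=> oU oV s [/oU[A UA] /oV[B VB]]; exists (A ++ B) => t st.
by split; [apply: UA|apply: VB] => x xA; apply: st; rewrite mem_cat xA ?orbT.
Qed.

Fact galgrp_open_bigU (I : Type) (f : I -> set (galois_group j)) :
  (forall i, galgrp_open (f i)) -> galgrp_open (\bigcup_i f i).
Proof.
move=> of_ s [i _ fis]; have [A fA] := of_ i s fis.
by exists A => t st; exists i => //; apply: fA.
Qed.

HB.instance Definition _ :=
  isOpenTopological.Build (galois_group j) galgrp_openT galgrp_openI galgrp_open_bigU.

Lemma galgrp_nbhsP s (U : set (galois_group j)) :
  nbhs s U <-> exists A : seq L, forall t, {in A, s =1 t} -> U t.
Proof.
rewrite nbhsE; split=> [[V [oV Vs] VU]|[A UA]].
  by have [A VA] := oV s Vs; exists A => t st; apply/VU/VA.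
exists [set t : galois_group j | {in A, s =1 t}]; last exact: UA.
split=> //; change (galgrp_open [set t : galois_group j | {in A, s =1 t}]).
move=> t st; exists A => u tu x xA; by rewrite (st x xA) (tu x xA).
Qed.

Fact galgrp_mul_continuous : continuous (fun st : galois_group j * galois_group j => (st.1 * st.2)%g).
Proof.
move=> [s t] U /galgrp_nbhsP[A UA].
exists ([set u : galois_group j | {in [seq t x | x <- A], s =1 u}],
        [set v : galois_group j | {in A, t =1 v}]).
  by split; apply/galgrp_nbhsP; [exists [seq t x | x <- A]|exists A].
move=> [u v] /= [su tv]; apply: UA => x xA.
change (s (t x) = u (v x)); rewrite -(tv x xA).
by apply: su; rewrite map_f.
Qed.

Fact galgrp_inv_continuous : continuous (fun s : galois_group j => s^-1%g).
Proof.
move=> s U /galgrp_nbhsP[A UA]; apply/galgrp_nbhsP.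
exists [seq galgrp_inv s x | x <- A] => t st; apply: UA => x xA.
change (galgrp_inv s x = galgrp_inv t x).
apply: (can_inj (galgrp_invK t).1); rewrite (galgrp_invK t).2.
by rewrite -st ?map_f // (galgrp_invK s).2.
Qed.

HB.instance Definition _ :=
  isTopGroup.Build (galois_group j) galgrp_mul_continuous galgrp_inv_continuous.

End KrullTopology.

Definition galois_extension (E L : fieldType) (j : {rmorphism E -> L}) : Prop :=
  (forall x, algebraicOver j x) /\
  (forall x, (forall s : galois_group j, s x = x) -> range j x).

Definition two_extension (E L : fieldType) (j : {rmorphism E -> L}) : Prop :=
  galois_extension j /\ pro2 (galois_group j).

Definition separable_closure (E Es : fieldType) (e : {rmorphism E -> Es}) : Prop :=
  (forall x, exists2 p, separable_poly p & root (map_poly e p) x) /\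
  (forall p : {poly Es}, separable_poly p -> (1 < size p)%N -> exists x, root p x).

(* [j : E -> L] is the maximal 2-extension of [E] inside the separable closure
   [e : E -> Es], [L] being viewed in [Es] through [k]. *)
Definition maximal_two_extension (E L Es : fieldType) (e : {rmorphism E -> Es})
    (j : {rmorphism E -> L}) (k : {rmorphism L -> Es}) : Prop :=
  [/\ k \o j =1 e, two_extension j
    & forall (M : fieldType) (jM : {rmorphism E -> M}) (kM : {rmorphism M -> Es}),
        kM \o jM =1 e -> two_extension jM -> range kM `<=` range k].

Definition nonzero (E : fieldType) : set E := [set x | x != 0].
Arguments nonzero : clear implicits.

Definition nonzero_squares (E : fieldType) : set E :=
  [set x ^+ 2 | x in nonzero E].
Arguments nonzero_squares : clear implicits.

Definition represented (E : fieldType) (a : E) : set E :=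
  [set z | z != 0 /\ exists x y, z = x ^+ 2 + a * y ^+ 2].

Definition kaplansky_radical (E : fieldType) : set E :=
  \bigcap_(a in nonzero E) represented a.
Arguments kaplansky_radical : clear implicits.

(* Main.v *)
Require Import Defs.
From mathcomp Require Import finmap.
From HB Require Import structures.
From mathcomp Require Import all_boot all_order all_algebra all_fingroup all_field.
From mathcomp Require Import cyclic pgroup ring.
From mathcomp Require Import boolp classical_sets functions cardinality filter.
From mathcomp Require Import topology.

Set Implicit Arguments.
Unset Strict Implicit.
Unset Printing Implicit Defensive.

Import GRing.Theory.

Local Open Scope card_scope.
Local Open Scope classical_set_scope.
Local Open Scope ring_scope.

(** Write L = F(2), G = G_F(2), and let eps : G -> Z/2 be the character of K,
    with kernel H = G_K(2).  For nonzero z, b in a field M, z is represented by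
    the form <1, -b> exactly when the cup product of the quadratic characters
    of z and b vanishes, that is, when there is c : G_M(2) -> Z/2 with
      c(gh) = c(g) + c(h) + z(g) b(h),
    a lift of the pair of characters to the group of unitriangular 3 x 3
    matrices over F_2 ([cup_of_norm], [norm_of_cup]).  Kummer theory
    ([kummer]) translates characters into square classes, since L is closed
    under square roots ([maximal_two_extension_sqrt]).  The Kaplansky radical
    of M thus consists of the characters whose cup products all vanish.

    On the free product G of G_0 and G_1, homomorphisms to finite 2-groups are
    given by their restrictions to the factors, arbitrary ones.  A class r in
    R(F) restricts to G_1 as a character whose cup product with every character
    of G_1 vanishes, because each such character extends to G; so this
    restriction is the character of an element of R(F_1), hence trivial
    ([radical_sgn]).

    Let z in K have norm r in R(F).  The two conjugates z_0, z_1 of z have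
    square roots in L that G permutes up to sign, and the signs define a
    homomorphism from G to a wreath product with Z/2.  As r is trivial on G_1,
    the two signs agree on G_1 and form a character of G_1, which extends to
    the character of some c in F.  After replacing z by cz all signs are trivial
    on G_1.  Then cz lies in R(K): for b in K, the signs of cz and b together
    map G to the wreath product (Z/2 x Z/2) wr Z/2, over eps.  It
    suffices to lift this map to U wr Z/2, where U is the unitriangular group,
    because on H a component of the lift is a cochain that kills the cup product
    of cz and b.  By the free product property a lift on each factor
    suffices: over G_1 the signs of cz vanish and the obvious lift works, over
    G_0 a lift exists because G_0 is free ([wreath_lift],
    [norm_of_trivial_signs]).  Passing from H to G by means of wreath products
    plays the part of Shapiro's lemma and replaces the description of the
    subgroup H of a free product by the Kurosh theorem.

    The other inclusion, which is independent of the structure of G, is the norm identity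
      N(x^2 + d y^2) = (N x - d N y)^2 + d Tr(x y')^2,
    where y' is the conjugate of y ([norm_radical]).

    The field theory behind this is that F(2) is Galois over F_1 and closed
    under square roots.  Both follow from the fact that the separable closure
    is Galois over each of its subfields containing F
    ([separable_closure_moves]); for square roots, the quadratic closure of
    F(2) is shown to be a 2-extension of F. *)

(** * Subfields as field types *)

Definition subfield_set (L : fieldType) (S : set L) : Prop :=
  [/\ S 1, forall x y, S x -> S y -> S (x - y)
    & forall x y, S x -> S y -> S (x / y)].

Section SubfieldType.
Variables (L : fieldType) (S : set L) (hS : subfield_set S).

Definition subfield_pred of subfield_set S : {pred L} := fun x => `[< S x >].

Fact subfield_pred_closed : divring_closed (subfield_pred hS).
Proof.
case: hS => S1 SB SV; split; first by rewrite unfold_in; apply/asboolP.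
- by move=> x y; rewrite !unfold_in => /asboolP Sx /asboolP Sy; apply/asboolP/SB.
- by move=> x y; rewrite !unfold_in => /asboolP Sx /asboolP Sy; apply/asboolP/SV.
Qed.

HB.instance Definition _ :=
  GRing.isDivringClosed.Build L (subfield_pred hS) subfield_pred_closed.

(** The closure proof [hS] is an argument of the predicate, so that the field
    structure of the subtype can be inferred from its type. *)
Record subfield_type := SubfieldElt {
  subfield_val :> L;
  subfield_mem : subfield_val \in subfield_pred hS }.

HB.instance Definition _ := [isSub for subfield_val].
HB.instance Definition _ := [Choice of subfield_type by <:].
HB.instance Definition _ :=
  [SubChoice_isSubIntegralDomain of subfield_type by <:].
HB.instance Definition _ := [SubIntegralDomain_isSubField of subfield_type by <:].

(** The projection gets its own morphism structure because simplification
    exposes it in place of the generic one. *)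
Fact subfield_val_zmod : zmod_morphism subfield_val.
Proof. exact: (rmorphB (\val : {rmorphism subfield_type -> L})). Qed.
Fact subfield_val_monoid : monoid_morphism subfield_val.
Proof.
by split; [exact: (rmorph1 (\val : {rmorphism subfield_type -> L}))
          | exact: (rmorphM (\val : {rmorphism subfield_type -> L}))].
Qed.
HB.instance Definition _ :=
  GRing.isZmodMorphism.Build subfield_type L subfield_val subfield_val_zmod.
HB.instance Definition _ :=
  GRing.isMonoidMorphism.Build subfield_type L subfield_val subfield_val_monoid.

Lemma subfield_in (x : L) : S x -> x \in subfield_pred hS.
Proof. by move=> Sx; rewrite unfold_in; apply/asboolP. Qed.

Lemma subfield_valP (x : subfield_type) : S (subfield_val x).
Proof. by have := subfield_mem x; rewrite unfold_in => /asboolP. Qed.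

Definition subfield_elt x (Sx : S x) : subfield_type := SubfieldElt (subfield_in Sx).

End SubfieldType.

(** * Algebraic elements and roots *)

Section Algebraic.
Variables (F L : fieldType) (e : {rmorphism F -> L}).

Lemma minimal_poly (x : L) : algebraicOver e x ->
  exists2 p : {poly F}, p != 0 &
    forall q, root (map_poly e q) x = (p %| q).
Proof.
move=> [p0 p0n0 rp0].
pose P n := `[< exists p : {poly F}, [/\ p != 0, root (map_poly e p) x & size p = n] >].
have exP : exists n, P n by exists (size p0); apply/asboolP; exists p0.
case: (ex_minnP exP) => n /asboolP[p [pn0 rp sp]] minn.
exists p => // q; apply/idP/idP => [rq|/dvdpP[r ->]]; last first.
  by rewrite rmorphM rootM rp orbT.
rewrite /dvdp; apply/eqP/eqP; apply: contraT => rn0.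
have : (n <= size (q %% p)%R)%N.
  apply: minn; apply/asboolP; exists (q %% p); split=> //.
  move: rq; rewrite {1}(divp_eq q p) rmorphD rmorphM /= /root hornerD hornerM.
  by rewrite (eqP rp) mulr0 add0r.
by rewrite -sp leqNgt ltn_modp pn0.
Qed.

Lemma algebraic_inv_poly (x : L) : algebraicOver e x ->
  exists q : {poly F}, x^-1 = (map_poly e q).[x].
Proof.
have [->|xn0] := eqVneq x 0; first by exists 0; rewrite rmorph0 horner0 invr0.
move=> /minimal_poly[p pn0 pP].
have p00 : p`_0 != 0.
  apply/eqP => p00.
  have /dvdpP[q] : 'X - 0%:P %| p by rewrite dvdp_XsubCl rootE horner_coef0 p00.
  rewrite polyC0 subr0 => qP.
  have : root (map_poly e p) x by rewrite pP.
  rewrite qP rmorphM rootM /= map_polyX rootX (negPf xn0) orbF pP => /dvdp_leq.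
  have qn0 : q != 0 by apply: contraNneq pn0 => q0; rewrite qP q0 mul0r.
  by rewrite qP size_mulX // ltnn => /(_ qn0).
have /dvdpP[q] : 'X - 0%:P %| p - (p`_0)%:P.
  by rewrite dvdp_XsubCl rootE !hornerE horner_coef0 subrr.
rewrite polyC0 subr0 => qP.
have qx : (map_poly e q).[x] * x = - e p`_0.
  have /eqP : root (map_poly e p) x by rewrite pP.
  rewrite -(subrK (p`_0)%:P p) qP rmorphD rmorphM /= map_polyX map_polyC /=.
  by rewrite !hornerE -qP subrK => /eqP; rewrite addr_eq0 => /eqP.
exists (- (p`_0)^-1 *: q); apply: (mulIf xn0).
rewrite mulVf // map_polyZ hornerZ rmorphN fmorphV -mulrA qx mulrNN mulVf //.
by rewrite fmorph_eq0.
Qed.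

(** The inverse of an algebraic element is a polynomial in it, so a subring
    that contains the base field is a subfield. *)
Lemma algebraic_subfield_set (S : set L) : (forall x, algebraicOver e x) ->
  range e `<=` S -> (forall x y, S x -> S y -> S (x - y)) ->
  (forall x y, S x -> S y -> S (x * y)) -> subfield_set S.
Proof.
move=> alg eS SB SM; split=> //; first by apply: eS; exists 1; rewrite ?rmorph1.
have SD x y : S x -> S y -> S (x + y).
  move=> Sx Sy; rewrite -(opprK y) -[- y]sub0r; apply/SB/SB => //.
  by apply: eS; exists 0; rewrite ?rmorph0.
move=> x y Sx Sy; apply/SM => //.
have [q ->] := algebraic_inv_poly (alg y).
elim/poly_ind: q => [|q c IH].
  by rewrite rmorph0 horner0; apply: eS; exists 0; rewrite ?rmorph0.
rewrite rmorphD rmorphM /= map_polyX map_polyC /= !hornerE; apply: SD.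
  exact: SM IH Sy.
by apply: eS; exists c.
Qed.

End Algebraic.

Lemma roots_seq (L : fieldType) (p : {poly L}) : p != 0 ->
  exists s : seq L, forall x, root p x = (x \in s).
Proof.
elim: {p}(size p) {-2}p (leqnn (size p)) => [|n IH] p sp pn0.
  by move: sp; rewrite leqn0 size_poly_eq0 (negPf pn0).
have [[x rx]|nr] := pselect (exists x, root p x); last first.
  by exists [::] => x; apply/negbTE/negP => rx; apply: nr; exists x.
have /factor_theorem[q qP] := rx.
have qn0 : q != 0 by apply: contraNneq pn0 => q0; rewrite qP q0 mul0r.
have [|s sP] := IH q _ qn0.
  by rewrite -ltnS (leq_trans _ sp) // qP size_Mmonic ?monicXsubC // size_XsubC addn2 ltnS.
by exists (x :: s) => y; rewrite qP rootM root_XsubC sP in_cons orbC.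
Qed.

(** An endomorphism permutes the finitely many roots of each polynomial over
    the base field. *)
Lemma algebraic_end_bij (F L : fieldType) (e : {rmorphism F -> L})
    (s : {rmorphism L -> L}) :
  (forall x, algebraicOver e x) -> (forall a, s (e a) = e a) -> bijective s.
Proof.
move=> alg se.
have surj y : exists x, s x == y.
  have [p pn0 rp] := alg y.
  have [|rs rsP] := @roots_seq L (map_poly e p); first by rewrite map_poly_eq0.
  have [] : (size [seq s x | x <- undup rs] = size (undup rs)) *
      ([seq s x | x <- undup rs] =i undup rs).
    have ui : uniq [seq s x | x <- undup rs].
      by rewrite map_inj_uniq ?undup_uniq //; exact: fmorph_inj.
    apply: uniq_min_size => //; last by rewrite size_map.
    move=> _ /mapP[x + ->]; rewrite !mem_undup -!rsP.
    have {2}-> : map_poly e p = map_poly s (map_poly e p).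
      by rewrite -map_poly_comp; apply: eq_map_poly => a /=; rewrite se.
    by rewrite fmorph_root.
  move=> _ eqm; have : y \in [seq s x | x <- undup rs] by rewrite eqm mem_undup -rsP.
  by move=> /mapP[x _ ->]; exists x.
exists (fun y => xchoose (surj y)) => [x|y].
  by apply: (fmorph_inj s); rewrite (eqP (xchooseP (surj _))).
by rewrite (eqP (xchooseP (surj _))).
Qed.

(** * Extending embeddings into a separable closure *)

Section Extension.
Variables (F L : fieldType) (e : {rmorphism F -> L}).
Hypothesis hL : separable_closure e.

Lemma separable_closure_algebraic (x : L) : algebraicOver e x.
Proof. by have [p sp rp] := hL.1 x; exists p => //; exact: separable_poly_neq0. Qed.
Let alg := separable_closure_algebraic.

Lemma separable_other_root (p : {poly L}) w : separable_poly p ->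
  (2 < size p)%N -> exists2 y, y != w & root p y.
Proof.
move=> sepp szp; have [y ry] := hL.2 p sepp (ltnW szp).
have [yw|] := eqVneq y w; last by exists y.
subst y; have /factor_theorem[q qP] := ry.
have [_ sepq co]: [/\ separable_poly ('X - w%:P), separable_poly q & coprimep ('X - w%:P) q].
  by move: sepp; rewrite qP mulrC separable_mul => /and3P[].
have szq : (1 < size q)%N.
  move: szp; rewrite qP size_Mmonic ?monicXsubC ?separable_poly_neq0 //.
  by rewrite size_XsubC addn2.
have [z rz] := hL.2 q sepq szq; exists z; last by rewrite qP rootM rz.
by apply: contraTneq rz => ->; rewrite -coprimep_XsubC coprimep_sym // coprimep_sym.
Qed.

(** Graphs of F-homomorphisms from subfields of L to L.  A graph is a subring of
    L x L, so unions of chains and adjunctions of elements need no gluing of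
    functions. *)
Record partial_hom (R : set (L * L)) : Prop := PartialHom {
  phom_base : forall a, R (e a, e a);
  phomB : forall u v, R u -> R v -> R (u - v);
  phomM : forall u v, R u -> R v -> R (u * v);
  phom_fun : forall y, R (0, y) -> y = 0 }.

Section Dom.
Variables (R : set (L * L)) (hR : partial_hom R).

Definition phom_dom : set L := [set x | exists y, R (x, y)].

Lemma phom_dom_subfield : subfield_set phom_dom.
Proof.
apply: (algebraic_subfield_set alg).
- by move=> _ [a _ <-]; exists (e a); exact: phom_base.
- by move=> x x' [y xy] [y' xy']; exists (y - y'); exact: (phomB hR xy xy').
- by move=> x x' [y xy] [y' xy']; exists (y * y'); exact: (phomM hR xy xy').
Qed.

Let A := subfield_type phom_dom_subfield.

Definition phom_val (x : A) : L := sval (cid (subfield_valP x)).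

Lemma phom_valP (x : A) : R (subfield_val x, phom_val x).
Proof. exact: svalP (cid (subfield_valP x)). Qed.

Lemma phom_uniq x y y' : R (x, y) -> R (x, y') -> y = y'.
Proof.
move=> xy xy'; apply/eqP; rewrite -subr_eq0; apply/eqP/(phom_fun hR).
by have := phomB hR xy xy'; rewrite -[_ - _]/(x - x, y - y') subrr.
Qed.

Lemma phom_valE (x : A) y : R (subfield_val x, y) -> phom_val x = y.
Proof. exact: phom_uniq (phom_valP x). Qed.

Fact phom_val_zmod : zmod_morphism phom_val.
Proof.
by move=> x y; apply: phom_valE; exact: (phomB hR (phom_valP x) (phom_valP y)).
Qed.

Fact phom_val_monoid : monoid_morphism phom_val.
Proof.
split; first by apply: phom_valE; have := phom_base hR 1; rewrite rmorph1.
by move=> x y; apply: phom_valE; exact: (phomM hR (phom_valP x) (phom_valP y)).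
Qed.

HB.instance Definition _ := GRing.isZmodMorphism.Build A L phom_val phom_val_zmod.
HB.instance Definition _ := GRing.isMonoidMorphism.Build A L phom_val phom_val_monoid.

Definition phom_emb (a : F) : A :=
  subfield_elt phom_dom_subfield (ex_intro _ (e a) (phom_base hR a)).

Fact phom_emb_zmod : zmod_morphism phom_emb.
Proof. by move=> x y; apply: val_inj; rewrite /= rmorphB. Qed.
Fact phom_emb_monoid : monoid_morphism phom_emb.
Proof. by split=> [|x y]; apply: val_inj; rewrite /= ?rmorph1 ?rmorphM. Qed.
HB.instance Definition _ := GRing.isZmodMorphism.Build F A phom_emb phom_emb_zmod.
HB.instance Definition _ := GRing.isMonoidMorphism.Build F A phom_emb phom_emb_monoid.

Lemma phom_val_emb a : phom_val (phom_emb a) = e a.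
Proof. by apply: phom_valE; exact: phom_base. Qed.

(** The image of x may be any root of the image of its minimal polynomial;
    that polynomial is separable of degree at least 2, whence a choice other
    than w. *)
Lemma phom_extend x w : ~ phom_dom x ->
  exists y R', [/\ y != w, partial_hom R', R `<=` R' & R' (x, y)].
Proof.
move=> xA.
have algA : algebraicOver (@subfield_val _ _ _ : A -> L) x.
  have [p pn0 rp] := alg x; exists (map_poly phom_emb p); first by rewrite map_poly_eq0.
  by rewrite -map_poly_comp (eq_map_poly (g := e)).
have [p pn0 pP] := minimal_poly algA.
have [s seps rs] := hL.1 x.
have sepp : separable_poly (map_poly phom_val p).
  rewrite separable_map.
  have : p %| map_poly phom_emb s.
    by rewrite -pP -map_poly_comp (eq_map_poly (g := e)).
  by move/dvdp_separable; apply; rewrite separable_map.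
have szp : (2 < size (map_poly phom_val p))%N.
  rewrite size_map_poly ltnNge; apply/negP => szp.
  have : root (map_poly (@subfield_val _ _ _) p) x by rewrite pP.
  have -> : p = (p`_1)%:P * 'X + (p`_0)%:P.
    apply/polyP => -[|[|i]]; rewrite !coefE //= ?mulr0 ?add0r ?mulr1 ?addr0 //.
    by rewrite nth_default // (leq_trans szp).
  rewrite rmorphD rmorphM /=; rewrite !map_polyC map_polyX /= /root !hornerE.
  have [p10|p10] := eqVneq p`_1 0.
    rewrite p10 /= mul0r add0r => /eqP p00; move/negP: pn0; apply.
    have p00' : p`_0 = 0 by exact: val_inj.
    apply/eqP/polyP => -[|[|i]]; rewrite ?p10 ?p00' coef0 //.
    by rewrite nth_default // (leq_trans szp).
  rewrite addr_eq0 => /eqP px; apply: xA.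
  have -> : x = subfield_val (- (p`_0) / p`_1).
    rewrite rmorphM fmorphV rmorphN /= -px mulrAC mulfV ?mul1r //.
  exact: subfield_valP.
have [y yw ry] := separable_other_root w sepp szp.
(* the graph of q(x) |-> q^sigma(y), where sigma is the given homomorphism *)
exists y, [set u | exists q : {poly A},
  u = ((map_poly (@subfield_val _ _ _) q).[x], (map_poly phom_val q).[y])]; split=> //.
- split.
  + move=> a; exists (phom_emb a)%:P.
    by rewrite !map_polyC /= !hornerC phom_val_emb.
  + by move=> _ _ [q ->] [q' ->]; exists (q - q'); rewrite !rmorphB !hornerE.
  + by move=> _ _ [q ->] [q' ->]; exists (q * q'); rewrite !rmorphM !hornerM.
  + move=> z [q [qx ->]].
    have /dvdpP[q' ->] : p %| q by rewrite -pP /root -qx.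
    by rewrite rmorphM hornerM (eqP ry) mulr0.
- move=> [u v] uv; have uA : phom_dom u by exists v.
  exists (subfield_elt phom_dom_subfield uA)%:P.
  by rewrite !map_polyC /= !hornerC (@phom_valE _ v).
- by exists 'X; rewrite !map_polyX !hornerX.
Qed.

End Dom.

(** By Zorn's lemma and [phom_extend], R lies in a graph with domain L; an
    endomorphism of an algebraic extension is bijective. *)
Lemma phom_extend_all R : partial_hom R ->
  exists g : galois_group e, forall x y, R (x, y) -> g x = y.
Proof.
move=> hR.
(* the empty set satisfies P, so that the empty chain has an upper bound *)
pose P X := forall u, X u -> R `<=` X /\ partial_hom X.
have [|M [PM Mmax]] := @Zorn_bigcup _ P.
  move=> C CP totC u [X CX Xu].
  have two v w : (\bigcup_(Y in C) Y) v -> (\bigcup_(Y in C) Y) w ->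
      exists Y, [/\ C Y, Y v, Y w & partial_hom Y].
    move=> [Y CY Yv] [Z CZ Zw]; have [YZ|ZY] := totC _ _ CY CZ.
      by exists Z; split=> //; [exact: YZ|have [] := CP _ CZ _ Zw].
    by exists Y; split=> //; [exact: ZY|have [] := CP _ CY _ Yv].
  have [RX hX] := CP _ CX _ Xu.
  split; first by move=> v /RX Xv; exists X.
  split.
  - by move=> a; exists X => //; exact: phom_base.
  - move=> v w /two tv /tv[Y [CY Yv Yw hY]]; exists Y => //; exact: phomB.
  - move=> v w /two tv /tv[Y [CY Yv Yw hY]]; exists Y => //; exact: phomM.
  - by move=> y [Y CY Yy]; have [_ hY] := CP _ CY _ Yy; exact: (phom_fun hY Yy).
have [v Mv] : exists v, M v.
  apply: contrapT => M0; apply: (Mmax R); last by move=> u Ru; split.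
  split; first by move=> u Mu; case: M0; exists u.
  by move=> /(_ _ (phom_base hR 0)) M00; apply: M0; exists (e 0, e 0).
have [RM hM] := PM _ Mv.
have domM x : phom_dom M x.
  apply: contrapT => xM; have [y [R' [_ hR' MR' R'xy]]] := phom_extend hM 0 xM.
  apply: (Mmax R'); last by move=> u _; split=> //; exact: subset_trans MR'.
  by split=> // R'M; apply: xM; exists y; exact: R'M.
pose s x := sval (cid (domM x)).
have sP x : M (x, s x) by exact: svalP (cid (domM x)).
have sE x y : M (x, y) -> s x = y by exact: phom_uniq hM _ _ _ (sP x).
have s1 : zmod_morphism s.
  by move=> x y; apply: sE; exact: (phomB hM (sP x) (sP y)).
have s2 : monoid_morphism s.
  split; first by apply: sE; have := phom_base hM 1; rewrite rmorph1.
  by move=> x y; apply: sE; exact: (phomM hM (sP x) (sP y)).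
have se a : s (e a) = e a by apply: sE; exact: phom_base.
pose s' : {rmorphism L -> L} := HB.pack s
  (GRing.isZmodMorphism.Build _ _ s s1) (GRing.isMonoidMorphism.Build _ _ s s2).
have sbij : bijective s := @algebraic_end_bij F L e s' alg se.
by exists (GaloisGroup s1 s2 sbij se) => x y /RM/sE.
Qed.

(** The separable closure is Galois over every subfield containing F: an
    element outside the subfield can be sent to another root of its minimal
    polynomial. *)
Theorem separable_closure_moves (A : set L) x :
  range e `<=` A -> (forall u v, A u -> A v -> A (u - v)) ->
  (forall u v, A u -> A v -> A (u * v)) -> ~ A x ->
  exists2 g : galois_group e, g x <> x & forall u, A u -> g u = u.
Proof.
move=> eA AB AM xA; pose R := [set u : L * L | A u.1 /\ u.1 = u.2].
have hR : partial_hom R.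
  split.
  - by move=> a; split=> //; apply: eA; exists a.
  - by move=> [u u'] [v v'] [/= Au <-] [/= Av <-]; split=> //; exact: AB.
  - by move=> [u u'] [v v'] [/= Au <-] [/= Av <-]; split=> //; exact: AM.
  - by move=> y [_ /= <-].
have [|y [R' [yx hR' RR' R'xy]]] := phom_extend hR x (x := x).
  by move=> [y [/= Ax _]].
have [g gP] := phom_extend_all hR'; exists g.
  by rewrite (gP _ _ R'xy); apply/eqP.
by move=> u Au; apply/gP/RR'.
Qed.

End Extension.

(** * Quotients of pro-2 groups *)

Section Index.
Variables (G : topGroupType) (U : set G) (nU : normal_subgroup U).
Local Open Scope group_scope.

Definition left_cosets : set (set G) :=
  [set [set x * u | u in U] | x in [set: G]].

Let U1 : U 1. Proof. by have [] := nU. Qed.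
Let UD x y : U x -> U y -> U (x * y^-1). Proof. by have [_ + _] := nU; apply. Qed.
Let UV x : U x -> U x^-1. Proof. by move=> Ux; rewrite -(mul1g x^-1); exact: UD. Qed.
Let UM x y : U x -> U y -> U (x * y).
Proof. by move=> Ux Uy; rewrite -(invgK y); exact/UD/UV. Qed.

Lemma left_coset_eq x y :
  [set x * u | u in U] = [set y * u | u in U] <-> U (x^-1 * y).
Proof.
split=> [xy|Uxy].
  have [u Uu <-] : [set x * u | u in U] y by rewrite xy; exists 1; rewrite ?mulg1.
  by rewrite mulKg.
apply/seteqP; split=> _ [u Uu <-].
  exists ((x^-1 * y)^-1 * u); last by rewrite invgM invgK -mulgA !mulKVg.
  exact/UM/Uu/UV.
by exists (x^-1 * y * u); [exact: UM | rewrite -mulgA mulKVg].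
Qed.

Lemma left_cosets_index N : left_cosets #= `I_N ->
  exists c : G -> 'I_N, (forall x y, c x = c y <-> U (x^-1 * y)) /\
    forall i, exists x, c x = i.
Proof.
move=> /card_set_bijP[f [ff fi fs]].
have fN x : (f [set (x * u)%g | u in U] < N)%N by apply: ff; exists x.
exists (fun x => Ordinal (fN x)); split=> [x y|i].
  rewrite -left_coset_eq; split=> [[/fi]|xy]; last by apply: val_inj; rewrite /= xy.
  by rewrite !inE; apply; [exists x | exists y].
have [_ [x _ <-] fx] := fs i (ltn_ord i).
by exists x; apply: val_inj.
Qed.

(** The quotient by U, realized as the group of right translations of the
    cosets, so that the theory of finite groups applies to it. *)
Lemma quotient_perm_group N : left_cosets #= `I_N ->
  exists (P : {group 'S_N}) (p : G -> 'S_N),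
    [/\ #|P| = N, {morph p : x y / x * y}, forall x, p x = 1 -> U x,
        forall x, U x -> p x = 1 & forall s, s \in P <-> exists x, p x = s].
Proof.
move=> /left_cosets_index[c [cE cs]].
pose r i := sval (cid (cs i)); have rK i : c (r i) = i by exact: svalP (cid (cs i)).
have cr x y : c (r (c x) * y) = c (x * y).
  apply/cE; have /cE := rK (c x) => Ux.
  rewrite invgM -mulgA (mulgA _ x).
  by have [_ _ nUJ] := nU; exact: nUJ.
have pi_inj g : injective (fun i => c (r i * g)).
  apply: (@can_inj _ _ _ (fun i => c (r i * g^-1))) => i.
  by rewrite cr mulgK rK.
pose p g := perm (pi_inj g).
have pM : {morph p : x y / x * y}.
  by move=> x y; apply/permP => i; rewrite permM !permE cr mulgA.
have p1 : p 1 = 1 by apply/permP => i; rewrite permE mulg1 rK perm1.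
have pU x : U x -> p x = 1.
  move=> Ux; apply/permP => i; rewrite permE perm1 -[RHS]rK; apply/cE.
  by rewrite invgM -mulgA mulVg mulg1; exact: UV.
have Up x : p x = 1 -> U x.
  move=> px; have : p x (c 1) = c 1 by rewrite px perm1.
  by rewrite permE cr mul1g => /esym/cE; rewrite invg1 mul1g.
pose P := [set s | `[< exists x, p x = s >]]%SET.
have PP s : reflect (exists x, p x = s) (s \in P) by rewrite inE; exact: asboolP.
have gP : group_set P.
  apply/group_setP; split; first by apply/PP; exists 1.
  by move=> _ _ /PP[x <-] /PP[y <-]; apply/PP; exists (x * y).
exists (Group gP), p; split=> //; last by move=> s; split=> /PP.
rewrite /= -[RHS]card_ord.
pose h (s : 'S_N) := s (c 1).
have hi : {in P &, injective h}.
  move=> _ _ /PP[x <-] /PP[y <-]; rewrite /h !permE !cr !mul1g => /cE Uxy.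
  by rewrite -(mulKVg x y) pM (pU _ Uxy) mulg1.
rewrite -(card_in_imset hi) -cardsT; apply: eq_card => i; rewrite !inE.
apply/imsetP; have [x xi] := cs i; exists (p x); first by apply/PP; exists x.
by rewrite /h permE cr mul1g.
Qed.

Lemma expg_index N x : left_cosets #= `I_N -> U (x ^+ N).
Proof.
move=> /quotient_perm_group[P [p [cP pM Up _ PP]]]; apply: Up.
have p1 : p 1 = 1 by apply: (mulgI (p 1)); rewrite -pM !mulg1.
have -> n : p (x ^+ n) = p x ^+ n.
  by elim: n => [|n IH]; rewrite ?expg0 // !expgS pM IH.
suff : p x ^+ #|P| = 1 by rewrite cP.
by apply/eqP; rewrite -order_dvdn order_dvdG //; apply/PP; exists x.
Qed.

(** By Cauchy's theorem a finite group whose elements have 2-power order is a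
    2-group. *)
Lemma two_power_index N : left_cosets #= `I_N ->
  (forall x, exists n, U (x ^+ (2 ^ n))) -> exists n, left_cosets #= `I_(2 ^ n).
Proof.
move=> cN two; have [P [p [cP pM Up pU PP]]] := quotient_perm_group cN.
suff /p_natP[n nP] : 2%N.-nat #|P| by exists n; rewrite -nP cP.
have p1 : p 1 = 1 by apply: (mulgI (p 1)); rewrite -pM !mulg1.
apply/pnatP => // q pr_q /(Cauchy pr_q)[s /PP[x <-] oq].
have [n /pU] := two x.
have -> k : p (x ^+ k) = p x ^+ k.
  by elim: k => [|k IH]; rewrite ?expg0 // !expgS pM IH.
move=> /eqP; rewrite -order_dvdn oq Euclid_dvdX // dvdn_prime2 //.
by case/andP.
Qed.

End Index.

Section Pro2.
Variable G : topGroupType.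
Local Open Scope group_scope.

Lemma translate_open (U : set G) (x : G) : open U -> open [set x * u | u in U].
Proof.
move=> oU.
have -> : [set x * u | u in U] = (fun t => x^-1 * t) @^-1` U.
  apply/seteqP; split=> [_ [u Uu <-]|t Ut]; first by rewrite /= mulKg.
  by exists (x^-1 * t) => //; rewrite mulKVg.
apply: open_comp => // t _.
apply: (@continuous_comp _ _ _ (fun t => (x^-1, t)) (fun st : G * G => st.1 * st.2)).
  by apply: cvg_pair; [exact: cvg_cst | exact: cvg_id].
exact: mulg_continuous.
Qed.

Lemma compact_index_finite (U : set G) : compact [set: G] -> open U ->
  normal_subgroup U -> finite_set (left_cosets U).
Proof.
move=> cG oU nU.
(* the cover form of compactness needs a point *)
pose PG : ptopologicalType := HB.pack (G : topologicalType) (isPointed.Build G 1).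
have cPG : @cover_compact PG setT by rewrite -compact_cover.
have [|x _|D _ DG] := cPG G setT (fun x => [set x * u | u in U]).
- by move=> x _; exact: translate_open.
- by exists x => //; exists 1; rewrite ?mulg1 //; have [] := nU.
have fB : finite_set ((fun x : G => [set x * u | u in U]) @` [set` D]).
  exact: finite_image.
apply: sub_finite_set fB => _ [x _ <-]; have [d Dd [u Uu <-]] := DG x Logic.I.
by exists d => //; apply/left_coset_eq => //; rewrite mulKg.
Qed.

(** Only the orders of elements in the discrete quotients have to be checked. *)
Lemma pro2_criterion : compact [set: G] ->
  (forall x y : G, x != y -> exists V : set G, [/\ clopen V, V x & ~ V y]) ->
  (forall U : set G, open U -> normal_subgroup U ->
     forall x, exists n, U (x ^+ (2 ^ n))) -> pro2 G.
Proof.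
move=> cG sep two; split=> //.
- rewrite open_hausdorff => x y /sep[V [[oV cV] Vx Vy]].
  exists (V, ~` V); first by rewrite !inE.
  by split=> //=; [exact: closed_openC | rewrite setICr].
- exact: zero_dimension_totally_disconnected.
- move=> U oU nU; have [N cN] := compact_index_finite cG oU nU.
  exact: two_power_index cN (two U oU nU).
Qed.

End Pro2.

(** * Galois groups of algebraic extensions *)

Section GaloisGroup.
Variables (E L : fieldType) (j : {rmorphism E -> L}).
Implicit Types g h : galois_group j.

HB.instance Definition _ g :=
  GRing.isZmodMorphism.Build L L (galgrp_fun g) (galgrp_zmod g).
HB.instance Definition _ g :=
  GRing.isMonoidMorphism.Build L L (galgrp_fun g) (galgrp_monoid g).

Lemma galgrpM g h x : (g * h)%g x = g (h x). Proof. by []. Qed.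
Lemma galgrp1E x : (1%g : galois_group j) x = x. Proof. by []. Qed.
Lemma galgrpVK g : cancel (g^-1)%g g.
Proof. by move=> x; rewrite -galgrpM mulgV. Qed.
Lemma galgrpK g : cancel g (g^-1)%g.
Proof. by move=> x; rewrite -galgrpM mulVg. Qed.

Lemma gal_one g : g 1 = 1. Proof. exact: rmorph1. Qed.
Lemma gal_nat g n : g n%:R = n%:R. Proof. exact: rmorph_nat. Qed.
Lemma gal_sign g (b : bool) : g ((-1) ^+ b) = (-1) ^+ b. Proof. exact: rmorph_sign. Qed.
Lemma gal_add g x y : g (x + y) = g x + g y. Proof. exact: rmorphD. Qed.
Lemma gal_sub g x y : g (x - y) = g x - g y. Proof. exact: rmorphB. Qed.
Lemma gal_mul g x y : g (x * y) = g x * g y. Proof. exact: rmorphM. Qed.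
Lemma gal_div g x y : g (x / y) = g x / g y. Proof. exact: fmorph_div. Qed.
Lemma gal_exp g x n : g (x ^+ n) = g x ^+ n. Proof. exact: rmorphXn. Qed.

Lemma gal_two_power_mono g n m x :
  (g ^+ (2 ^ n))%g x = x -> (g ^+ (2 ^ (n + m)))%g x = x.
Proof.
by rewrite expnD expgnA => gx; elim: (2 ^ m)%N => // k IH; rewrite expgSr galgrpM gx.
Qed.

Lemma gal_fix_powers g (A : seq L) : (forall x, exists n, (g ^+ (2 ^ n))%g x = x) ->
  exists n, {in A, forall x, (g ^+ (2 ^ n))%g x = x}.
Proof.
move=> two; elim: A => [|x A [n nP]]; first by exists 0%N.
have [m mx] := two x; exists (n + m)%N => y; rewrite in_cons => /orP[/eqP ->|yA].
  by rewrite addnC gal_two_power_mono.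
by rewrite gal_two_power_mono // nP.
Qed.

Hypothesis alg : forall x, algebraicOver j x.

Lemma gal_conjugates x : exists rs : seq L, forall g, g x \in rs.
Proof.
have [p pn0 rp] := alg x.
have [|rs rsP] := @roots_seq L (map_poly j p); first by rewrite map_poly_eq0.
exists rs => g; rewrite -rsP.
have {1}-> : map_poly j p = map_poly g (map_poly j p).
  by rewrite -map_poly_comp; apply: eq_map_poly => a /=; rewrite galgrp_fix.
by rewrite fmorph_root.
Qed.

Lemma ultra_seq_value (T : Type) (C : set_system T) (f : T -> L) (rs : seq L) :
  UltraFilter C -> (forall t, f t \in rs) -> exists y, C [set t | f t = y].
Proof.
move=> CU frs; have : C [set t | f t \in rs].
  by apply: filterS (filterT) => t _; exact: frs.
elim: rs {frs} => [|y rs IH] Crs.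
  by have [t] := filter_ex Crs.
have [|Cy] := in_ultra_setVsetC [set t | f t = y] CU; first by exists y.
apply: IH; apply: filterS (filterI Crs Cy) => t /= [].
by rewrite in_cons => /orP[/eqP|].
Qed.

(** An ultrafilter on the group has a limit at each x, as g x takes finitely
    many values; these limits form an automorphism.  The limits of g^-1 x give
    its inverse. *)
Lemma galois_group_compact : compact [set: galois_group j].
Proof.
rewrite compact_ultra => C CU _.
have sex x : exists y, C [set g : galois_group j | g x = y].
  have [rs rsP] := gal_conjugates x.
  exact: (ultra_seq_value CU rsP).
have tex x : exists y, C [set g : galois_group j | (g^-1)%g x = y].
  have [rs rsP] := gal_conjugates x.
  by apply: (ultra_seq_value (rs := rs) CU) => g; exact: rsP.
pose s x := sval (cid (sex x)); pose t x := sval (cid (tex x)).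
have sP x : C [set g : galois_group j | g x = s x] by exact: svalP (cid (sex x)).
have tP x : C [set g : galois_group j | (g^-1)%g x = t x] by exact: svalP (cid (tex x)).
have s1 : zmod_morphism s.
  move=> x y; have [g [[/= <- <-] <-]] := filter_ex (filterI (filterI (sP x) (sP y)) (sP (x - y))).
  by rewrite rmorphB.
have s2 : monoid_morphism s.
  split; first by have [g /= <-] := filter_ex (sP 1); rewrite rmorph1.
  move=> x y; have [g [[/= <- <-] <-]] := filter_ex (filterI (filterI (sP x) (sP y)) (sP (x * y))).
  by rewrite rmorphM.
have s3 : bijective s.
  exists t => x.
    by have [g [/= sg <-]] := filter_ex (filterI (sP x) (tP (s x))); rewrite -sg galgrpK.
  by have [g [/= tg <-]] := filter_ex (filterI (tP x) (sP (t x))); rewrite -tg galgrpVK.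
have s4 a : s (j a) = j a.
  by have [g /= <-] := filter_ex (sP (j a)); rewrite galgrp_fix.
pose s' := GaloisGroup s1 s2 s3 s4.
exists s'; split=> // U /galgrp_nbhsP[A AU]; apply: filterS (AU) _.
elim: A {AU} => [|x A IH]; first by apply: filterS filterT.
apply: filterS (filterI (sP x) IH) => g [/= gx gA] y.
by rewrite in_cons => /orP[/eqP ->|/gA].
Qed.

Lemma gal_value_open x y : open [set g : galois_group j | g x = y].
Proof.
by move=> g /= <-; exists [:: x] => t /(_ x) -> //; rewrite mem_head.
Qed.

Lemma gal_value_clopen x y : clopen [set g : galois_group j | g x = y].
Proof.
split; first exact: gal_value_open.
rewrite -[X in closed X]setCK; apply: open_closedC.
move=> g /= gx; exists [:: x] => t gt; rewrite -(gt x) ?mem_head //.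
Qed.

(** A local criterion for pro-2 Galois groups, convenient for inductions on the
    construction of field elements. *)
Lemma galois_group_pro2 :
  (forall g x, exists n, (g ^+ (2 ^ n))%g x = x) -> pro2 (galois_group j).
Proof.
move=> two; apply: pro2_criterion; first exact: galois_group_compact.
  move=> g h gh; have [x gx] : exists x, g x <> h x.
    apply: contrapT => gh'; move/eqP: gh; apply; apply: galgrpP => x.
    by apply: contrapT => gx; apply: gh'; exists x.
  exists [set u : galois_group j | u x = g x]; split=> //.
    exact: gal_value_clopen.
  by move=> /= /esym.
move=> U oU [U1 _ _] g.
have [A AU] := oU 1%g U1; have [n nA] := gal_fix_powers A (two g).
by exists n; apply: AU => x /nA ->.
Qed.

Lemma pro2_galois_group : pro2 (galois_group j) ->
  forall g x, exists n, (g ^+ (2 ^ n))%g x = x.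
Proof.
move=> [_ _ _ idx] g x.
have [rs rsP] := gal_conjugates x.
(* the stabilizer of x need not be normal, that of all its conjugates is *)
pose O := [set y | exists h : galois_group j, h x = y].
pose U := [set h : galois_group j | forall y, O y -> h y = y].
have nU : normal_subgroup U.
  split=> //.
  + by move=> h k hU kU y Oy; rewrite galgrpM -{1}(kU y Oy) galgrpK hU.
  + move=> h k hU y [l <-]; rewrite /conjg !galgrpM hU ?galgrpK //.
    by exists (k * l)%g.
have [|n cU] := idx U _ nU.
  move=> h hU; exists rs => t ht y [k <-].
  by rewrite -ht ?rsP // hU //; exists k.
by exists n; apply: (expg_index nU g cU); exists 1%g.
Qed.

End GaloisGroup.

(** The product over the orbit of x has coefficients fixed by the group. *)
Lemma galois_split_poly (E L : fieldType) (j : {rmorphism E -> L}) (x : L) :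
  galois_extension j -> exists (p : {poly E}) (rs : seq L),
    x \in rs /\ map_poly j p = \prod_(y <- rs) ('X - y%:P).
Proof.
move=> [alg fixE]; have [rs rsP] := gal_conjugates alg x.
pose orb := undup [seq y <- rs | `[< exists g : galois_group j, g x = y >]].
have orbP y : (y \in orb) = `[< exists g : galois_group j, g x = y >].
  rewrite mem_undup mem_filter; case: asboolP => //= -[g <-]; exact: rsP.
pose P := \prod_(y <- orb) ('X - y%:P).
have gP (g : galois_group j) : map_poly g P = P.
  rewrite rmorph_prod /= (eq_bigr (fun y => 'X - (g y)%:P)); last first.
    by move=> y _; rewrite rmorphB /= map_polyX map_polyC.
  rewrite -(big_map g xpredT (fun y => 'X - y%:P)); apply: perm_big.
  have ug : uniq [seq g y | y <- orb].
    by rewrite map_inj_uniq ?undup_uniq //; exact: fmorph_inj.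
  apply: uniq_perm => //; first exact: undup_uniq.
  apply: (uniq_min_size ug _ _).2; last by rewrite size_map.
  move=> _ /mapP[y + ->]; rewrite !orbP => /asboolP[h <-].
  by apply/asboolP; exists (g * h)%g.
have Pj i : exists a, j a = P`_i.
  have [g|a _ <-] := fixE P`_i; last by exists a.
  by rewrite -{2}(gP g) coef_map.
exists (\poly_(i < size P) sval (cid (Pj i))), orb; split.
  by rewrite orbP; apply/asboolP; exists 1%g.
apply/polyP => i; rewrite coef_map coef_poly; case: ltnP => [_|sP].
  exact: svalP (cid (Pj i)).
by rewrite nth_default //; exact: rmorph0.
Qed.

(** * The maximal 2-extension over its subfields *)

Lemma galois_restrict (F E M L : fieldType) (e : {rmorphism F -> L})
    (jE : {rmorphism E -> M}) (k : {rmorphism M -> L}) (g : galois_group e) :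
  (forall x, range k (g (k x))) -> (forall x, range k ((g^-1)%g (k x))) ->
  (forall a, g (k (jE a)) = k (jE a)) ->
  exists h : galois_group jE, forall x, k (h x) = g (k x).
Proof.
move=> gk gVk gfix.
have sx x : exists y, k y = g (k x) by have [y _ <-] := gk x; exists y.
have tx x : exists y, k y = (g^-1)%g (k x) by have [y _ <-] := gVk x; exists y.
pose s x := sval (cid (sx x)); have sP x : k (s x) = g (k x) := svalP (cid (sx x)).
pose t x := sval (cid (tx x)).
have tP x : k (t x) = (g^-1)%g (k x) := svalP (cid (tx x)).
have kI := fmorph_inj k.
have s1 : zmod_morphism s by move=> x y; apply: kI; rewrite rmorphB !sP !rmorphB.
have s2 : monoid_morphism s.
  by split=> [|x y]; apply: kI; rewrite ?rmorphM !sP ?rmorph1 // !rmorphM.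
have s3 : bijective s.
  by exists t => x; apply: kI; rewrite ?(sP, tP) ?(sP, tP) ?galgrpK ?galgrpVK.
have s4 a : s (jE a) = jE a by apply: kI; rewrite sP gfix.
by exists (GaloisGroup s1 s2 s3 s4).
Qed.

Lemma galois_normal (F M L : fieldType) (e : {rmorphism F -> L})
    (j : {rmorphism F -> M}) (k : {rmorphism M -> L}) (g : galois_group e) x :
  k \o j =1 e -> galois_extension j -> range k (g (k x)).
Proof.
move=> kj hj; have [p [rs [xrs pE]]] := galois_split_poly x hj.
have pe : map_poly e p = \prod_(y <- [seq k y | y <- rs]) ('X - y%:P).
  rewrite big_map -(eq_map_poly kj) map_poly_comp pE rmorph_prod.
  by apply: eq_bigr => y _; rewrite rmorphB /= map_polyX map_polyC.
have : root (map_poly e p) (g (k x)).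
  have -> : map_poly e p = map_poly g (map_poly e p).
    by rewrite -map_poly_comp; apply: eq_map_poly => a /=; rewrite galgrp_fix.
  by rewrite fmorph_root pe root_prod_XsubC map_f.
by rewrite pe root_prod_XsubC => /mapP[y _ ->]; exists y.
Qed.

(** Galois theory of a possibly infinite extension L of F: L is Galois over each
    intermediate field M.  An automorphism of Fs moving x and fixing M restricts
    to L because L is normal over F. *)
Lemma intermediate_fixed_field (F Fs L M : fieldType) (e : {rmorphism F -> Fs})
    (j : {rmorphism F -> L}) (k : {rmorphism L -> Fs})
    (i : {rmorphism F -> M}) (jM : {rmorphism M -> L}) x :
  separable_closure e -> k \o j =1 e -> galois_extension j -> jM \o i =1 j ->
  (forall s : galois_group jM, s x = x) -> range jM x.
Proof.
move=> he kj hj ji sx; apply: contrapT => xM.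
have [|||[u _ /fmorph_inj ux]|g gx gM] :=
    @separable_closure_moves F Fs e he [set k (jM u) | u in [set: M]] (k x).
- by move=> _ [a _ <-]; exists (i a) => //; rewrite -(kj a) /= -(ji a).
- by move=> _ _ [u _ <-] [v _ <-]; exists (u - v); rewrite ?rmorphB.
- by move=> _ _ [u _ <-] [v _ <-]; exists (u * v); rewrite ?rmorphM.
- by apply: xM; exists u.
have [||u|h hP] := @galois_restrict _ _ _ _ e jM k g.
- by move=> u; exact: galois_normal kj hj.
- by move=> u; exact: galois_normal kj hj.
- by apply: gM; exists u.
by apply: gx; rewrite -hP sx.
Qed.

Section QuadraticClosure.
Variables (F Fs L : fieldType) (e : {rmorphism F -> Fs}) (j : {rmorphism F -> L})
  (k : {rmorphism L -> Fs}).
Hypotheses (char2 : 2%N \notin [pchar F]) (he : separable_closure e)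
  (kj : k \o j =1 e) (hj : two_extension j).

(** A subring that is algebraic over F is a subfield, so these clauses generate
    the closure of L in Fs under the field operations and square roots. *)
Inductive quadratic_closure : Fs -> Prop :=
| qclos_base x : quadratic_closure (k x)
| qclosB x y : quadratic_closure x -> quadratic_closure y -> quadratic_closure (x - y)
| qclosM x y : quadratic_closure x -> quadratic_closure y -> quadratic_closure (x * y)
| qclos_sqrt x : quadratic_closure (x ^+ 2) -> quadratic_closure x.

Let alg := separable_closure_algebraic he.

Lemma quadratic_closure_subfield : subfield_set quadratic_closure.
Proof.
apply: (algebraic_subfield_set alg).
- by move=> _ [a _ <-]; rewrite -(kj a); exact: qclos_base.
- exact: qclosB.
- exact: qclosM.
Qed.

Let Q := subfield_type quadratic_closure_subfield.
Let kQ : {rmorphism Q -> Fs} := @subfield_val _ _ quadratic_closure_subfield.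

Definition quadratic_closure_emb (a : F) : Q :=
  subfield_elt quadratic_closure_subfield (qclos_base (j a)).

Fact qclos_emb_zmod : zmod_morphism quadratic_closure_emb.
Proof. by move=> x y; apply: val_inj; rewrite /= !rmorphB. Qed.
Fact qclos_emb_monoid : monoid_morphism quadratic_closure_emb.
Proof. by split=> [|x y]; apply: val_inj; rewrite /= ?rmorph1 ?rmorphM. Qed.
HB.instance Definition _ :=
  GRing.isZmodMorphism.Build F Q quadratic_closure_emb qclos_emb_zmod.
HB.instance Definition _ :=
  GRing.isMonoidMorphism.Build F Q quadratic_closure_emb qclos_emb_monoid.
Let jQ : {rmorphism F -> Q} := quadratic_closure_emb.

Let kjQ : kQ \o jQ =1 e. Proof. by move=> a; rewrite -(kj a). Qed.

Lemma quadratic_closure_stable (g : galois_group e) x :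
  quadratic_closure x -> quadratic_closure (g x).
Proof.
elim=> {x} [x|x y _ IHx _ IHy|x y _ IHx _ IHy|x _ IH].
- by have [y _ <-] := galois_normal g x kj hj.1; exact: qclos_base.
- by rewrite rmorphB; exact: qclosB.
- by rewrite rmorphM; exact: qclosM.
- by apply: qclos_sqrt; rewrite -rmorphXn.
Qed.

Let algQ (x : Q) : algebraicOver jQ x.
Proof.
have [p pn0 rp] := alg (kQ x); exists p => //.
rewrite -(fmorph_root kQ) -map_poly_comp.
by rewrite (eq_map_poly (g := e)).
Qed.

Lemma quadratic_closure_galois : galois_extension jQ.
Proof.
split=> // x fx; apply: contrapT => xF.
have [|||[u _ ux]|g gx gF] := @separable_closure_moves F Fs e he (range e) (kQ x).
- by [].
- by move=> _ _ [u _ <-] [v _ <-]; exists (u - v); rewrite ?rmorphB.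
- by move=> _ _ [u _ <-] [v _ <-]; exists (u * v); rewrite ?rmorphM.
- by apply: xF; exists u => //; apply: (fmorph_inj kQ); rewrite -ux -(kjQ u).
have rQ h y : range kQ ((h : galois_group e) (kQ y)).
  have Qy := quadratic_closure_stable h (subfield_valP y).
  by exists (subfield_elt quadratic_closure_subfield Qy).
have [||a|h hP] := @galois_restrict _ _ _ _ e jQ kQ g.
- by move=> y; exact: rQ.
- by move=> y; exact: rQ.
- by rewrite -[kQ (jQ a)]/((kQ \o jQ) a) kjQ galgrp_fix.
by apply: gx; rewrite -hP fx.
Qed.

(** By induction on the construction of x: if h fixes x^2 then h x is x or -x,
    and h^2 fixes x. *)
Lemma quadratic_closure_two_power (g : galois_group jQ) x :
  exists n, (g ^+ (2 ^ n))%g x = x.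
Proof.
suff H y : quadratic_closure y -> forall x : Q, kQ x = y ->
    exists n, (g ^+ (2 ^ n))%g x = x by exact: H (subfield_valP x) x erefl.
have qelt z (qz : quadratic_closure z) : exists x : Q, kQ x = z.
  by exists (subfield_elt quadratic_closure_subfield qz).
have mono n m (z : Q) : (g ^+ (2 ^ n))%g z = z -> (g ^+ (2 ^ (n + m)))%g z = z.
  exact: gal_two_power_mono.
elim=> {y x} [y|y z Qy IHy Qz IHz|y z Qy IHy Qz IHz|y Qy IH] x xE.
  (* an element of L: g restricts to L, whose group over F is pro-2 *)
- pose kL (u : L) : Q := subfield_elt quadratic_closure_subfield (qclos_base u).
  have kL1 : zmod_morphism kL by move=> u v; apply: val_inj; rewrite /= rmorphB.
  have kL2 : monoid_morphism kL.
    by split=> [|u v]; apply: val_inj; rewrite /= ?rmorph1 ?rmorphM.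
  pose kL' : {rmorphism L -> Q} := HB.pack kL
    (GRing.isZmodMorphism.Build _ _ kL kL1) (GRing.isMonoidMorphism.Build _ _ kL kL2).
  have kLj : kL' \o j =1 jQ by move=> a; apply: val_inj.
  have [||a|h hP] := @galois_restrict F F L Q jQ j kL' g.
  + by move=> u; exact: galois_normal kLj hj.1.
  + by move=> u; exact: galois_normal kLj hj.1.
  + by rewrite -[kL' (j a)]/((kL' \o j) a) kLj galgrp_fix.
  have [n hn] := pro2_galois_group hj.1.1 hj.2 h y; exists n.
  have -> : x = kL' y by apply: val_inj.
  have hX m u : (g ^+ m)%g (kL' u) = kL' ((h ^+ m)%g u).
    by elim: m u => // m IHm u; rewrite !expgSr !galgrpM -hP IHm.
  by rewrite hX hn.
- have [[u uE] [v vE]] := (qelt y Qy, qelt z Qz).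
  have -> : x = u - v by apply: (fmorph_inj kQ); rewrite xE rmorphB uE vE.
  have [[n nu] [m mv]] := (IHy u uE, IHz v vE).
  by exists (n + m)%N; rewrite galgrp_zmod (mono n) // (addnC n m) (mono m).
- have [[u uE] [v vE]] := (qelt y Qy, qelt z Qz).
  have -> : x = u * v by apply: (fmorph_inj kQ); rewrite xE rmorphM uE vE.
  have [[n nu] [m mv]] := (IHy u uE, IHz v vE).
  by exists (n + m)%N; rewrite (galgrp_monoid _).2 (mono n) // (addnC n m) (mono m).
- have [|n nx] := IH (x ^+ 2); first by rewrite rmorphXn xE.
  move: nx; rewrite rmorphXn => /eqP; rewrite eqf_sqr => /orP[]/eqP nx.
    by exists n.
  by exists n.+1; rewrite expnSr expgnA expg2 galgrpM nx -sub0r galgrp_zmod nx rmorph0 opprK add0r.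
Qed.

Lemma quadratic_closure_two_extension : two_extension jQ.
Proof.
split; first exact: quadratic_closure_galois.
exact: galois_group_pro2 algQ quadratic_closure_two_power.
Qed.

(** The quadratic closure of L in Fs is a 2-extension of F, hence equal to L. *)
Lemma maximal_two_extension_sqrt (b : L) :
  maximal_two_extension e j k -> exists c, c ^+ 2 = b.
Proof.
move=> [_ _ maxL]; have [->|bn0] := eqVneq b 0; first by exists 0; rewrite expr0n.
have n2 : 2%:R != 0 :> Fs.
  rewrite -(rmorph_nat e) fmorph_eq0; apply: contra char2 => n2.
  by rewrite inE /=.
have sepp : separable_poly ('X^2 - (k b)%:P).
  rewrite separable_poly.unlock derivB derivC subr0 derivXn /= expr1.
  (* - b^-1 (X^2 - b) + X / (2 b) * 2 X = 1 *)
  apply/Bezout_coprimepP; exists ((- (k b)^-1)%:P, ((2%:R * k b)^-1)%:P * 'X).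
  have -> : (- (k b)^-1)%:P * ('X^2 - (k b)%:P) + ((2%:R * k b)^-1)%:P * 'X * ('X *+ 2)
      = 1; last exact: eqpxx.
  have kb : k b != 0 by rewrite fmorph_eq0.
  have HI : ((2%:R * k b)^-1)%:P *+ 2 = ((k b)^-1)%:P.
    by rewrite -polyCMn -(mulr_natl ((2%:R * k b)^-1) 2) invfM mulrA divff ?mul1r.
  have IB : ((k b)^-1)%:P * (k b)%:P = 1 by rewrite -polyCM mulVf.
  rewrite -[RHS]IB polyCN; move: HI IB.
  set H := ((_ * _)^-1)%:P; set I := ((k b)^-1)%:P; set B := (k b)%:P => HI IB.
  have -> : - I * ('X^2 - B) + H * 'X * ('X *+ 2) = I * B + (H *+ 2 - I) * 'X^2 by ring.
  by rewrite HI subrr mul0r addr0.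
have [|c rc] := he.2 ('X^2 - (k b)%:P) sepp; first by rewrite size_XnsubC.
have cE : c ^+ 2 = k b.
  by move: rc; rewrite /root !hornerE subr_eq0 => /eqP.
have Qc : quadratic_closure c by apply: qclos_sqrt; rewrite cE; exact: qclos_base.
have [|y _ yc] := maxL Q jQ kQ kjQ quadratic_closure_two_extension c.
  by exists (subfield_elt quadratic_closure_subfield Qc).
by exists y; apply: (fmorph_inj k); rewrite rmorphXn yc.
Qed.

End QuadraticClosure.

(** * Quadratic characters and cup products *)

(** Dedekind's lemma for characters of a multiplicative submonoid P of L.  The
    usual argument: compare the relation at y x with chi_i(y) times the relation
    at x, for y separating chi_i from another character. *)
Lemma dedekind_independence (L : fieldType) (I : eqType) (P : set L)
    (chi : I -> L -> L) (s : seq I) (a : I -> L) :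
  P 1 -> (forall x y, P x -> P y -> P (x * y)) -> (forall i, chi i 1 = 1) ->
  (forall i x y, P x -> P y -> chi i (x * y) = chi i x * chi i y) ->
  {in s &, forall i k, i != k -> exists2 x, P x & chi i x != chi k x} ->
  uniq s ->
  (forall x, P x -> \sum_(i <- s) a i * chi i x = 0) -> {in s, forall i, a i = 0}.
Proof.
move=> P1 PM chi1 chiM; elim: s a => [//|i s IH] a sep /andP[is_ us] sum0.
have as0 : {in s, forall k, a k = 0}.
  move=> k ks; have [|||y Py yik] := sep i k; rewrite ?mem_head ?in_cons ?ks ?orbT //.
    by apply: contraNneq is_ => ->.
  suff /eqP : a k * (chi k y - chi i y) = 0.
    by rewrite mulf_eq0 subr_eq0 [chi k y == _]eq_sym (negPf yik) orbF => /eqP.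
  apply: (IH (fun l => a l * (chi l y - chi i y)) _ us _ k ks).
  - by move=> l m ls ms; apply: sep; rewrite in_cons ?ls ?ms orbT.
  - move=> x Px; have := sum0 (y * x) (PM _ _ Py Px).
    have := sum0 x Px; rewrite !big_cons chiM // => sx syx.
    transitivity ((a i * (chi i y * chi i x) + \sum_(l <- s) a l * chi l (y * x))
       - chi i y * (a i * chi i x + \sum_(l <- s) a l * chi l x)); last first.
      by rewrite sx syx mulr0 subrr.
    rewrite mulrDr opprD addrACA mulrCA subrr add0r mulr_sumr -sumrB.
    by apply: eq_bigr => l _; rewrite chiM //; ring.
move=> k; rewrite in_cons => /orP[/eqP ->|/as0//].
have := sum0 1 P1; rewrite big_cons chi1 mulr1 big_seq big1 ?addr0 // => l ls.
by rewrite as0 ?mul0r.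
Qed.

Section Signs.
Variables (E L : fieldType) (j : {rmorphism E -> L}).
Implicit Types g h : galois_group j.

Definition subgroup_set (H : set (galois_group j)) : Prop :=
  [/\ H 1%g, forall g h, H g -> H h -> H (g * h)%g & forall g, H g -> H (g^-1)%g].

Definition trivial_near1 (H : set (galois_group j)) (f : galois_group j -> bool) :=
  exists A : seq L, forall g, H g -> {in A, forall x, g x = x} -> f g = false.

Hypothesis alg : forall x, algebraicOver j x.

(** Hilbert's theorem 90 for the signs of f.  Let A witness that f is locally
    constant.  The elements of H take finitely many values on A, and those with
    different values give different characters of the monoid M fixed by the
    stabilizer of A in H; by independence some Lagrange resolvent
    S(x) = sum of (-1)^f(g) g(x), x in M, is not zero. *)
Theorem kummer (H : set (galois_group j)) (f : galois_group j -> bool) :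
  subgroup_set H -> (forall g h, H g -> H h -> f (g * h)%g = f g (+) f h) ->
  trivial_near1 H f ->
  exists2 w, w != 0 & forall g, H g -> g w = (-1) ^+ f g * w.
Proof.
move=> [H1 HM HV] fM [A fA].
pose v g := [seq g x | x <- A].
have [T vT] : exists T : seq (seq L), forall g, v g \in T.
  rewrite /v; elim: A {fA v} => [|x A [T IH]].
    by exists [:: [::]] => g; rewrite mem_seq1.
  have [rs rsP] := gal_conjugates alg x.
  by exists [seq y :: t | y <- rs, t <- T] => g; exact: (allpairs_f cons (rsP g) (IH g)).
have eqv g h : v g = v h -> {in A, g =1 h} by move/eq_in_map.
pose att t := exists2 g, H g & v g = t.
pose orb := undup [seq t <- T | `[< att t >]].
have orbP t : (t \in orb) = `[< att t >].
  by rewrite mem_undup mem_filter; case: asboolP => //= -[g _ <-]; exact: vT.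
have ex_rep t : exists g, att t -> H g /\ v g = t.
  by have [[g Hg vg]|nt] := pselect (att t); [exists g | exists 1%g].
pose rep t := sval (cid (ex_rep t)).
have repP t : att t -> H (rep t) /\ v (rep t) = t := svalP (cid (ex_rep t)).
pose M := [set x | forall g, H g -> {in A, forall y, g y = y} -> g x = x].
have agree g h x : H g -> H h -> v g = v h -> M x -> g x = h x.
  move=> Hg Hh /eqv gh Mx; rewrite -[g x](galgrpVK h); congr (h _).
  rewrite -galgrpM; apply: Mx; first by apply: HM => //; exact: HV.
  by move=> y yA; rewrite galgrpM gh // galgrpK.
have fV h : H h -> f (h^-1)%g = f h.
  move=> Hh; have := fM _ _ (HV _ Hh) Hh; rewrite mulVg fA //.
  by case: (f h); case: (f _).
have agreef g h : H g -> H h -> v g = v h -> f g = f h.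
  move=> Hg Hh /eqv gh.
  have fk : f (h^-1 * g)%g = false.
    apply: fA; first by apply: HM => //; exact: HV.
    by move=> y yA; rewrite galgrpM gh // galgrpK.
  have := fM _ _ (HV _ Hh) Hg; rewrite fk fV //.
  by case: (f g); case: (f h).
pose S x := \sum_(t <- orb) (-1) ^+ f (rep t) * rep t x.
have [x Mx Sx] : exists2 x, M x & S x != 0.
  apply: contrapT => S0.
  suff /eqP : (-1) ^+ f (rep (v 1%g)) = 0 :> L by rewrite signr_eq0.
  apply: (@dedekind_independence L (seq L) M rep orb (fun t => (-1) ^+ f (rep t))).
  - by move=> g _ _; rewrite rmorph1.
  - by move=> x y Mx My g Hg gA; rewrite (galgrp_monoid g).2 Mx ?My.
  - by move=> t; rewrite rmorph1.
  - by move=> t x y _ _; rewrite rmorphM.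
  - move=> t u; rewrite !orbP => /asboolP/repP[Ht vt] /asboolP/repP[Hu vu] tu.
    apply: contrapT => nx; move/eqP: tu; apply; rewrite -vt -vu.
    apply/eq_in_map => y yA; apply: contrapT => yne; apply: nx; exists y.
      by move=> g _; exact.
    exact/eqP.
  - exact: undup_uniq.
  - move=> x Mx; apply: contrapT => Sx; apply: S0; exists x => //; exact/eqP.
  - by rewrite orbP; apply/asboolP; exists 1%g.
exists (S x) => // g Hg.
rewrite rmorph_sum /= mulr_sumr.
have ug : uniq [seq map g t | t <- orb].
  by rewrite map_inj_uniq ?undup_uniq //; apply: inj_map; exact: fmorph_inj.
have po : perm_eq orb [seq map g t | t <- orb].
  rewrite perm_sym; apply: uniq_perm => //; first exact: undup_uniq.
  apply: (uniq_min_size ug _ _).2; last by rewrite size_map.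
  move=> _ /mapP[t + ->]; rewrite !orbP => /asboolP[h Hh <-].
  by apply/asboolP; exists (g * h)%g; [exact: HM | rewrite /v -map_comp].
rewrite [RHS](perm_big _ po) big_map /= !big_seq; apply: eq_bigr => t.
rewrite orbP => /asboolP att_t; have [Ht vt] := repP _ att_t.
have vgt : v (g * rep t)%g = map g t by rewrite -{2}vt /v -map_comp.
have att_gt : att (map g t) by exists (g * rep t)%g => //; exact: HM.
have [Hgt vg] := repP _ att_gt.
have eq_gt : v (rep (map g t)) = v (g * rep t)%g by rewrite vg vgt.
rewrite (agree _ _ _ Hgt (HM _ _ Hg Ht) eq_gt Mx).
rewrite (agreef _ _ Hgt (HM _ _ Hg Ht) eq_gt) fM // rmorphM rmorph_sign /=.
by rewrite mulrA; congr (_ * _); rewrite signr_addb signrMK.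
Qed.



Hypothesis n2 : (2%:R : L) != 0.

Lemma sign_inj (b b' : bool) (x : L) : x != 0 ->
  (-1) ^+ b * x = (-1) ^+ b' * x -> b = b'.
Proof.
move=> xn0 /(mulIf xn0); case: b; case: b' => //=; rewrite expr1 expr0 => /eqP.
  by rewrite eq_sym -subr_eq0 opprK -mulr2n (negPf n2).
by rewrite -subr_eq0 opprK -mulr2n (negPf n2).
Qed.

(** The sign, as a boolean, by which g acts on a square root x of a fixed
    element. *)
Definition sgn (x : L) g : bool := g x != x.

Lemma sgnE x g : g (x ^+ 2) = x ^+ 2 -> g x = (-1) ^+ sgn x g * x.
Proof.
move=> gx2; have : (g x) ^+ 2 == x ^+ 2 by rewrite -[X in _ == X]gx2 gal_exp.
rewrite /sgn eqf_sqr; case: eqP => [-> _|_ /= /eqP ->].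
  by rewrite /= expr0 mul1r.
by rewrite /= expr1 mulN1r.
Qed.

Lemma sgnM x g h : x != 0 -> g (x ^+ 2) = x ^+ 2 -> h (x ^+ 2) = x ^+ 2 ->
  sgn x (g * h)%g = sgn x g (+) sgn x h.
Proof.
move=> xn0 gx hx; apply: (sign_inj xn0).
rewrite -sgnE ?galgrpM ?hx //.
by rewrite (sgnE hx) gal_mul gal_sign (sgnE gx) /= mulrA -signr_addb addbC.
Qed.

(** If the cup product of the characters of al^2 and be^2 is the coboundary of c,
    then al^2 is a norm from M(be), where M is the fixed field of H.  On the
    kernel H' of the character of be, c is a character, given by some om.  For
    tau in H outside H', the element v = om tau(om) transforms like al, so that
    al = v / ka with ka in M, while v^2 is the norm of om^2 in M(be). *)
Lemma norm_of_cup (H : set (galois_group j)) (al be : L) (c : galois_group j -> bool) :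
  subgroup_set H -> al != 0 -> be != 0 ->
  (forall g, H g -> g (al ^+ 2) = al ^+ 2) ->
  (forall g, H g -> g (be ^+ 2) = be ^+ 2) ->
  (forall g h, H g -> H h -> c (g * h)%g = c g (+) c h (+) (sgn al g && sgn be h)) ->
  trivial_near1 H c ->
  exists p q, [/\ forall g, H g -> g p = p, forall g, H g -> g q = q
    & al ^+ 2 = p ^+ 2 - be ^+ 2 * q ^+ 2].
Proof.
move=> [H1 HM HV] aln0 ben0 Hal Hbe cM [A cA].
have [[tau Htau st]|nt] := pselect (exists2 g, H g & sgn be g); last first.
  have Hb g : H g -> g be = be.
    move=> Hg; apply/eqP/negPn/negP => gb; apply: nt; exists g => //.
  (* be lies in M and the form is hyperbolic *)
  exists ((al ^+ 2 + 1) / 2%:R), ((al ^+ 2 - 1) / (2%:R * be)); split.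
  - by move=> g Hg; rewrite gal_div gal_add Hal // gal_one gal_nat.
  - move=> g Hg.
    by rewrite gal_div gal_sub Hal // gal_one gal_mul gal_nat Hb.
  - by field; rewrite n2 ben0.
have sbM g h : H g -> H h -> sgn be (g * h)%g = sgn be g (+) sgn be h.
  by move=> Hg Hh; apply: sgnM; rewrite ?Hbe.
have sb1 : sgn be 1%g = false by rewrite /sgn galgrp1E eqxx.
have sbV g : H g -> sgn be (g^-1)%g = sgn be g.
  move=> Hg; have := sbM _ _ (HV _ Hg) Hg; rewrite mulVg sb1.
  by case: (sgn be g); case: (sgn _ _).
pose H' := [set g | H g /\ sgn be g = false].
have sH' : subgroup_set H'.
  split=> //; first by move=> g h [Hg sg] [Hh sh]; split; [exact: HM | rewrite sbM // sg sh].
  by move=> g [Hg sg]; split; [exact: HV | rewrite sbV].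
have [||om omn0 omP] := @kummer H' c sH'.
- by move=> g h [Hg sg] [Hh sh]; rewrite cM // sh andbF addbF.
- by exists A => g [Hg _]; exact: cA.
pose tc g := (tau^-1 * (g * tau))%g.
have Htc g : H' g -> H' (tc g).
  move=> [Hg sg]; have Hgt := HM _ _ Hg Htau; have HVt := HV _ Htau.
  split; first exact: HM HVt Hgt.
  by rewrite !sbM // sbV // sg st.
have tcE g : (tau * tc g)%g = (g * tau)%g by rewrite /tc mulKVg.
have c_tc g : H' g -> c (tc g) = c g (+) sgn al g.
  move=> Hg; have [[Hg1 _] [Ht1 Ht2]] := (Hg, Htc g Hg).
  have := congr1 c (tcE g); rewrite (cM tau (tc g)) // (cM g tau) // st Ht2 andbT andbF.
  by case: (c tau); case: (c (tc g)); case: (c g); case: (sgn al g).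
have fixH x : (forall g, H' g -> g x = x) -> tau x = x -> forall g, H g -> g x = x.
  move=> H'x tx g Hg; case sg: (sgn be g); last exact: H'x.
  have HVt := HV _ Htau.
  rewrite -{1}(mulKVg tau g) galgrpM H'x //; split; first exact: HM HVt Hg.
  by rewrite sbM // sbV // sg st.
pose v := om * tau om.
have gv g : H' g -> g v = (-1) ^+ sgn al g * v.
  move=> Hg; rewrite /v gal_mul omP // -galgrpM -tcE galgrpM (omP _ (Htc g Hg)).
  rewrite gal_mul gal_sign /= c_tc //.
  by rewrite signr_addb; case: (c g); rewrite /= ?expr0 ?expr1; ring.
have tt : H' (tau * tau)%g by split; [exact: HM | rewrite sbM // st].
have tv : tau v = (-1) ^+ sgn al tau * v.
  rewrite /v gal_mul -galgrpM (omP _ tt) cM // st andbT addbb addFb.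
  by rewrite mulrCA [tau om * om]mulrC.
have vn0 : v != 0 by rewrite mulf_neq0 // fmorph_eq0.
pose ka := v / al; have kan0 : ka != 0 by rewrite mulf_neq0 // invr_eq0.
have kaP : forall g, H g -> g ka = ka.
  have sq (s : bool) : ((-1) ^+ s * v) / ((-1) ^+ s * al) = ka.
    by rewrite -mulf_div divff ?mul1r // signr_eq0.
  apply: fixH => [g Hg|]; rewrite gal_div.
    by rewrite gv // (sgnE (Hal _ Hg.1)) sq.
  by rewrite tv (sgnE (Hal _ Htau)) sq.
pose w := om ^+ 2.
have gw g : H' g -> g w = w.
  by move=> Hg; rewrite gal_exp omP // exprMn sqrr_sign mul1r.
have gtw g : H' g -> g (tau w) = tau w.
  by move=> Hg; rewrite -galgrpM -tcE galgrpM gw //; exact: Htc.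
have ttw : tau (tau w) = w by rewrite -galgrpM gw.
have tbe : tau be = - be by rewrite (sgnE (Hbe _ Htau)) st mulN1r.
(* w = p0 + be q0, tau w = p0 - be q0 *)
pose p0 := (w + tau w) / 2%:R; pose q0 := (w - tau w) / (2%:R * be).
have p0P : forall g, H g -> g p0 = p0.
  apply: fixH => [g Hg|]; rewrite gal_div gal_nat gal_add.
    by rewrite gw // gtw.
  by rewrite ttw addrC.
have q0P : forall g, H g -> g q0 = q0.
  apply: fixH => [g Hg|]; rewrite gal_div gal_mul gal_nat gal_sub.
    by rewrite gw // gtw // (sgnE (Hbe _ Hg.1)) Hg.2 mul1r.
  by rewrite ttw tbe mulrN invrN mulrN -mulNr opprB.
exists (p0 / ka), (q0 / ka); split.
- by move=> g Hg; rewrite gal_div p0P ?kaP.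
- by move=> g Hg; rewrite gal_div q0P ?kaP.
have vE : v ^+ 2 = p0 ^+ 2 - be ^+ 2 * q0 ^+ 2.
  rewrite /v exprMn -gal_exp -/w /p0 /q0.
  by field; rewrite n2 ben0.
have -> : al ^+ 2 = v ^+ 2 / ka ^+ 2.
  by rewrite /ka expr_div_n invf_div mulrA mulrAC divff ?mul1r // expf_neq0.
by rewrite vE; field.
Qed.

(** Conversely, if al^2 = x^2 - be^2 y^2, choose om^2 = x + be y; the signs of the
    action on om and its conjugate al / om give c. *)
Lemma cup_of_norm (al be x y om : L) :
  al != 0 -> be != 0 -> al ^+ 2 = x ^+ 2 - be ^+ 2 * y ^+ 2 ->
  om ^+ 2 = x + be * y ->
  (forall g, g (al ^+ 2) = al ^+ 2) -> (forall g, g (be ^+ 2) = be ^+ 2) ->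
  (forall g, g x = x) -> (forall g, g y = y) ->
  exists2 c, (forall g h, c (g * h)%g = c g (+) c h (+) (sgn al g && sgn be h))
    & trivial_near1 setT c.
Proof.
move=> aln0 ben0 alE omE gal2 gbe2 gx gy.
have omn0 : om != 0.
  apply: contraNneq aln0 => om0; rewrite -sqrf_eq0 alE.
  have -> : x ^+ 2 - be ^+ 2 * y ^+ 2 = (x + be * y) * (x - be * y) by ring.
  by rewrite -omE om0 expr0n /= mul0r.
pose om_ (b : bool) := if b then al / om else om.
have om_n0 b : om_ b != 0 by case: b => //=; rewrite mulf_neq0 ?invr_eq0.
have om_2 b : om_ b ^+ 2 = x + (-1) ^+ b * be * y.
  case: b => /=; last by rewrite mul1r.
  apply: (mulIf (_ : om ^+ 2 != 0)); first by rewrite expf_neq0.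
  rewrite expr_div_n mulfVK ?expf_neq0 // omE alE; ring.
have al_om b : al / om_ b = om_ (~~ b).
  by case: b => //=; rewrite invf_div mulrA mulrAC divff ?mul1r.
pose c g := g om != om_ (sgn be g).
have gom g : g om = (-1) ^+ c g * om_ (sgn be g).
  have : (g om) ^+ 2 == om_ (sgn be g) ^+ 2.
    rewrite -gal_exp omE gal_add gal_mul gx gy om_2 (sgnE (gbe2 g)).
    by [].
  rewrite eqf_sqr /c; case: eqP => [-> _|_ /= /eqP ->]; first by rewrite mul1r.
  by rewrite mulN1r.
have gom_ g b : g (om_ b) = (-1) ^+ (c g (+) (sgn al g && b)) * om_ (sgn be g (+) b).
  case: b; last by rewrite andbF !addbF -gom.
  rewrite /= gal_div gom (sgnE (gal2 g)) andbT addbT -al_om signr_addb.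
  by rewrite invfM invr_sign; ring.
exists c.
  move=> g h; apply: (sign_inj (om_n0 (sgn be (g * h)%g))).
  rewrite -gom galgrpM gom gal_mul gal_sign gom_ sgnM //= mulrA -signr_addb.
  by rewrite addbA [c h (+) c g]addbC.
exists [:: om; be] => g _ gA; apply/negbTE/negPn.
by rewrite /sgn !gA ?inE ?eqxx ?orbT.
Qed.

End Signs.

(** * A wreath product and lifting over a free product *)

Definition heis : Type := bool * bool * bool.

(** For [kap = true], the group of unitriangular 3 x 3 matrices over F_2; for
    [kap = false], the elementary abelian group on the same set. *)
Definition heis_mul (kap : bool) (u v : heis) : heis :=
  (u.1.1 (+) v.1.1, u.1.2 (+) v.1.2, u.2 (+) v.2 (+) (kap && u.1.1 && v.1.2)).

Definition heis_inv (kap : bool) (u : heis) : heis :=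
  (u.1.1, u.1.2, u.2 (+) (kap && u.1.1 && u.1.2)).

(** The wreath product with Z/2 of the group above, for both values of [kap] on
    the same set. *)
Definition wreath (kap : bool) : Type := heis * heis * bool.

Section Wreath.
Variable kap : bool.
Implicit Types u v w : wreath kap.

HB.instance Definition _ := Choice.copy (wreath kap) (heis * heis * bool)%type.
HB.instance Definition _ := Finite.copy (wreath kap) (heis * heis * bool)%type.

Definition wcoord (b : bool) u : heis := if b then u.1.2 else u.1.1.

Definition wreath_one : wreath kap :=
  ((false, false, false), (false, false, false), false).
Definition wreath_mul u v : wreath kap :=
  (heis_mul kap u.1.1 (wcoord u.2 v), heis_mul kap u.1.2 (wcoord (~~ u.2) v), u.2 (+) v.2).
Definition wreath_inv u : wreath kap :=
  (heis_inv kap (wcoord u.2 u), heis_inv kap (wcoord (~~ u.2) u), u.2).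

Fact heis_mulA : associative (heis_mul kap).
Proof. by case: kap => [] [[[] []] []] [[[] []] []] [[[] []] []]. Qed.

Fact wreath_mulA : associative wreath_mul.
Proof.
by move=> u [[v0 v1] f] w; rewrite /wreath_mul /= addbA; case: u.2; case: f => /=;
  rewrite !heis_mulA.
Qed.
Fact wreath_mul1 : left_id wreath_one wreath_mul.
Proof.
by move=> u; rewrite /wreath_mul /heis_mul; case: kap;
  case: u => -[[[[] []] []] [[[] []] []]] [].
Qed.
Fact wreath_1mul : right_id wreath_one wreath_mul.
Proof.
by move=> u; rewrite /wreath_mul /heis_mul; case: kap;
  case: u => -[[[[] []] []] [[[] []] []]] [].
Qed.
Fact wreath_mulV : left_inverse wreath_one wreath_inv wreath_mul.
Proof.
by move=> u; rewrite /wreath_inv /heis_inv /wreath_mul /heis_mul; case: kap;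
  case: u => -[[[[] []] []] [[[] []] []]] [].
Qed.
Fact wreath_Vmul : right_inverse wreath_one wreath_inv wreath_mul.
Proof.
by move=> u; rewrite /wreath_inv /heis_inv /wreath_mul /heis_mul; case: kap;
  case: u => -[[[[] []] []] [[[] []] []]] [].
Qed.

HB.instance Definition _ := isGroup.Build (wreath kap)
  wreath_mulA wreath_mul1 wreath_1mul wreath_mulV wreath_Vmul.

(** The discrete topology. *)
Definition wreath_open (U : set (wreath kap)) : Prop := True.
Fact wreath_openT : wreath_open setT. Proof. by []. Qed.
Fact wreath_openI U V : wreath_open U -> wreath_open V -> wreath_open (U `&` V).
Proof. by []. Qed.
Fact wreath_open_bigU (I : Type) (f : I -> set (wreath kap)) :
  (forall i, wreath_open (f i)) -> wreath_open (\bigcup_i f i).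
Proof. by []. Qed.
HB.instance Definition _ := isOpenTopological.Build (wreath kap)
  wreath_openT wreath_openI wreath_open_bigU.

Lemma wreath_nbhs u (U : set (wreath kap)) : nbhs u U <-> U u.
Proof.
split; first exact: nbhs_singleton.
by move=> Uu; rewrite nbhsE; exists U.
Qed.

Fact wreath_mul_continuous :
  continuous (fun uv : wreath kap * wreath kap => (uv.1 * uv.2)%g).
Proof.
move=> [u v] U /wreath_nbhs Uuv; exists ([set u], [set v]).
  by split; apply/wreath_nbhs.
by move=> [u' v'] /= [-> ->].
Qed.

Lemma wreath_continuous (T : topologicalType) (f : wreath kap -> T) : continuous f.
Proof. by move=> u U /nbhs_singleton Uu; apply/wreath_nbhs. Qed.

HB.instance Definition _ := isTopGroup.Build (wreath kap)
  wreath_mul_continuous (@wreath_continuous _ _).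

End Wreath.

Lemma wreath_exp8 (kap : bool) (u : wreath kap) : (u ^+ 8 = 1)%g.
Proof.
by case: kap u => -[[[[[] []] []] [[[] []] []]] []]; vm_compute.
Qed.

Lemma wreath_pro2 (kap : bool) : pro2 (wreath kap).
Proof.
apply: pro2_criterion.
- exact/finite_compact/finite_finset.
- move=> u v uv; exists [set u]; split=> //; last by move=> /= /esym/eqP; apply/negP.
  split; first by [].
  by rewrite -[X in closed X]setCK; apply: open_closedC.
- by move=> U _ [U1 _ _] u; exists 3%N; rewrite wreath_exp8.
Qed.




Lemma continuous_hom_comp (G H K : topGroupType) (f : G -> H) (g : H -> K) :
  continuous_hom f -> continuous_hom g -> continuous_hom (g \o f).
Proof.
move=> [fM fc] [gM gc]; split=> [x y|x]; first by rewrite /= fM gM.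
by apply: continuous_comp; [exact: fc | exact: gc].
Qed.

Lemma hom1 (G H : topGroupType) (f : G -> H) :
  {morph f : x y / (x * y)%g} -> f 1%g = 1%g.
Proof. by move=> fM; apply: (mulgI (f 1%g)); rewrite -fM !mulg1. Qed.

(** The projection of U wr Z/2 onto (Z/2 x Z/2) wr Z/2, the latter realized
    inside the abelian variant by elements with trivial corner entries. *)
Definition wreath_forget (u : wreath true) : wreath false :=
  ((u.1.1.1, false), (u.1.2.1, false), u.2).

Lemma wreath_forget_hom : continuous_hom wreath_forget.
Proof.
split; last exact: wreath_continuous.
by move=> [[[[z0 t0] c0] [[z1 t1] c1]] []] [[[[z0' t0'] c0'] [[z1' t1'] c1']] e'].
Qed.

Definition pro2_coproduct (G0 G1 G : topGroupType) (i0 : G0 -> G) (i1 : G1 -> G) :=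
  forall H : topGroupType, pro2 H ->
    forall (f0 : G0 -> H) (f1 : G1 -> H), continuous_hom f0 -> continuous_hom f1 ->
    exists! f : G -> H, [/\ continuous_hom f, f \o i0 = f0 & f \o i1 = f1].

(** A lift to U wr Z/2 on the factor G1 extends to the free product: on G0, lift
    the values of Phi on a basis, with trivial corner entries.  That the result
    projects to Phi follows from the uniqueness part of the universal
    properties. *)
Lemma wreath_lift (G0 G1 G : topGroupType) (i0 : G0 -> G) (i1 : G1 -> G)
    (Phi : G -> wreath false) (Psi1 : G1 -> wreath true) :
  free_pro2 G0 -> continuous_hom i0 -> continuous_hom i1 ->
  pro2_coproduct i0 i1 ->
  continuous_hom Phi -> continuous_hom Psi1 ->
  wreath_forget \o Psi1 = Phi \o i1 -> (forall g, wreath_forget (Phi g) = Phi g) ->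
  exists Psi : G -> wreath true,
    [/\ continuous_hom Psi, wreath_forget \o Psi = Phi & Psi \o i1 = Psi1].
Proof.
move=> [_ [X [iota [iota1 free]]]] hi0 hi1 univ hPhi hPsi1 Psi1E abelPhi.
pose f x : wreath true := Phi (i0 (iota x)).
have fE x : wreath_forget (f x) = Phi (i0 (iota x)) by rewrite -[RHS]abelPhi.
have conv (kap : bool) (g : X -> wreath kap) :
    (forall x, Phi (i0 (iota x)) = 1%g -> g x = 1%g) -> converges_to_1 g.
  move=> g1 U /wreath_nbhs U1.
  have nV : nbhs 1%g [set u | Phi (i0 u) = 1%g].
    have [_ /(_ 1%g) c] := continuous_hom_comp hi0 hPhi.
    have := c [set 1%g]; apply; apply/wreath_nbhs.
    by rewrite /= (hom1 hi0.1) (hom1 hPhi.1).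
  apply: sub_finite_set (iota1 _ nV) => x /= nU Phi1; apply: nU; by rewrite g1.
have [|phi [[hphi phiE] _]] := free _ (wreath_pro2 true) f.
  by apply: conv => x fx; exact: fx.
have abel_phi : wreath_forget \o phi = Phi \o i0.
  have [|chi [_ chi_uniq]] := free _ (wreath_pro2 false) (fun x => Phi (i0 (iota x))).
    exact: conv.
  transitivity chi; [apply: esym|]; apply: chi_uniq; split.
  - exact: continuous_hom_comp hphi wreath_forget_hom.
  - apply: funext => x; rewrite /= -fE; congr wreath_forget.
    by rewrite -[LHS]/((phi \o iota) x) phiE.
  - exact: continuous_hom_comp hi0 hPhi.
  - by [].
have [Psi [[hPsi Psi0 Psi1'] _]] := univ _ (wreath_pro2 true) _ _ hphi hPsi1.
exists Psi; split=> //.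
have [Th [_ Th_uniq]] := univ _ (wreath_pro2 false) _ _
  (continuous_hom_comp hi0 hPhi) (continuous_hom_comp hi1 hPhi).
transitivity Th; [apply: esym|]; apply: Th_uniq; split=> //.
- exact: continuous_hom_comp hPsi wreath_forget_hom.
- by rewrite -compA Psi0.
- by rewrite -compA Psi1'.
Qed.

Section GaloisHom.
Variables (E L : fieldType) (j : {rmorphism E -> L}).

Lemma galois_hom_continuous kap (f : galois_group j -> wreath kap) (A : seq L) :
  {morph f : g h / (g * h)%g} ->
  (forall g : galois_group j, {in A, forall x, g x = x} -> f g = 1%g) -> continuous_hom f.
Proof.
move=> fM fA; split=> // g U /wreath_nbhs Ug.
apply/galgrp_nbhsP; exists A => h gh; rewrite /= (_ : f h = f g) //.
rewrite -(mulKVg g h) fM (fA (g^-1 * h)%g) ?mulg1 // => x xA.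
by rewrite galgrpM -gh // galgrpK.
Qed.

Lemma continuous_near1 (H : topGroupType) (f : galois_group j -> H) (V : set H) :
  continuous_hom f -> nbhs 1%g V ->
  exists A : seq L, forall g : galois_group j, {in A, forall x, g x = x} -> V (f g).
Proof.
move=> [fM fc] V1.
have /galgrp_nbhsP[A AV] : nbhs (1%g : galois_group j) (f @^-1` V).
  by apply: fc; rewrite hom1.
by exists A => g gA; apply: AV => x xA; rewrite galgrp1E gA.
Qed.

End GaloisHom.

(** * Square classes over a free product *)

Section FreeProduct.
Variables (F F0 F1 L : fieldType).
Variables (j : {rmorphism F -> L}) (j0 : {rmorphism F0 -> L}) (j1 : {rmorphism F1 -> L}).
Hypotheses (n2 : (2%:R : L) != 0) (sqrtL : forall b : L, exists c, c ^+ 2 = b).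
Hypotheses (galj : galois_extension j) (galj1 : galois_extension j1).
Variables (i0 : galois_group j0 -> galois_group j) (i1 : galois_group j1 -> galois_group j).
Hypotheses (hi0 : continuous_hom i0) (hi1 : continuous_hom i1).
Hypothesis univ : pro2_coproduct i0 i1.
Hypothesis free0 : free_pro2 (galois_group j0).

Lemma subgroup_setT (E M : fieldType) (k : {rmorphism E -> M}) :
  subgroup_set [set: galois_group k].
Proof. by split. Qed.

(** Characters of G1 are extended to G by the trivial character on G0.  The target
    Z/2 enters as the complement of the base group of the wreath product, of
    which it is also a quotient. *)
Lemma sign_extend (xi : galois_group j1 -> bool) :
  {morph xi : g h / (g * h)%g >-> g (+) h} -> trivial_near1 setT xi ->
  exists X : galois_group j -> bool,
    [/\ {morph X : g h / (g * h)%g >-> g (+) h}, trivial_near1 setT X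
      & forall h, X (i1 h) = xi h].
Proof.
move=> xiM [A xiA]; pose o : heis := (false, false, false).
pose f1 h : wreath false := (o, o, xi h).
have hf1 : continuous_hom f1.
  apply: (galois_hom_continuous (A := A)).
    by move=> g h; rewrite /f1 xiM; case: (xi g).
  by move=> g gA; rewrite /f1 xiA.
have hf0 : continuous_hom (fun _ : galois_group j0 => 1%g : wreath false).
  apply: (galois_hom_continuous (A := [::])) => //.
have [f [[hf _ ff1] _]] := univ (wreath_pro2 false) hf0 hf1.
exists (fun g => (f g).2); split.
- by move=> g h; rewrite hf.1.
- have [|B fB] := continuous_near1 (V := [set 1%g]) hf; first exact/wreath_nbhs.
  by exists B => g _ /fB ->.
- by move=> h; rewrite -[f (i1 h)]/((f \o i1) h) ff1.
Qed.

Lemma kummer_square_root (E : fieldType) (k : {rmorphism E -> L}) (X : galois_group k -> bool) :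
  galois_extension k ->
  {morph X : g h / (g * h)%g >-> g (+) h} -> trivial_near1 setT X ->
  exists c de, [/\ c != 0, de ^+ 2 = k c & forall g, sgn de g = X g].
Proof.
move=> [alg fixk] XM X1.
have [|de den0 deP] := @kummer _ _ k alg setT X (subgroup_setT k) _ X1.
  by move=> g h _ _; exact: XM.
have [g|c _ cE] := fixk (de ^+ 2).
  by rewrite gal_exp deP // exprMn sqrr_sign mul1r.
exists c, de; split=> //; first by rewrite -(fmorph_eq0 k) cE expf_neq0.
move=> g; apply: (sign_inj n2 den0); rewrite -(sgnE (g := g)) ?deP //.
by rewrite gal_exp deP // exprMn sqrr_sign mul1r.
Qed.

Lemma fix_near1 (x : L) :
  exists A : seq L, forall h : galois_group j1, {in A, forall y, h y = y} -> i1 h x = x.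
Proof.
apply: (continuous_near1 (V := [set g : galois_group j | g x = x]) hi1).
by apply/galgrp_nbhsP; exists [:: x] => g gx; rewrite /= -gx ?mem_head.
Qed.

Hypothesis hrad : kaplansky_radical F1 = nonzero_squares F1.

(** Let m in F1 represent the square class of the restriction to G1 of the
    character of r.  For b in F1, the character of -b extends to the character of some d in
    F; as r is represented by <1, -d>, the cup product of the characters of r
    and d vanishes, and so does its restriction to G1.  Hence m is in R(F1), that
    is, a square. *)
Lemma radical_sgn (r : F) (rho : L) : kaplansky_radical F r -> rho ^+ 2 = j r ->
  forall h, sgn rho (i1 h) = false.
Proof.
move=> rR rhoE.
have rn0 : r != 0 by have [|] := rR 1; first exact: oner_neq0.
have rhon0 : rho != 0 by rewrite -sqrf_eq0 rhoE fmorph_eq0.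
have rho2 (g : galois_group j) : g (rho ^+ 2) = rho ^+ 2 by rewrite rhoE galgrp_fix.
have [||m [mu [mn0 muE muP]]] := @kummer_square_root _ j1 (fun h => sgn rho (i1 h)) galj1.
- by move=> g h; rewrite hi1.1 sgnM.
- by have [A AP] := fix_near1 rho; exists A => g _ /AP; rewrite /sgn => ->; rewrite eqxx.
have mun0 : mu != 0 by rewrite -sqrf_eq0 muE fmorph_eq0.
suff : kaplansky_radical F1 m.
  rewrite hrad => -[n _ nE] h; rewrite -muP /sgn.
  have : mu ^+ 2 == (j1 n) ^+ 2 by rewrite muE -nE rmorphXn.
  by rewrite eqf_sqr => /orP[]/eqP ->; rewrite -?rmorphN galgrp_fix eqxx.
move=> b bn0; split=> //.
have [be beE] := sqrtL (j1 (- b)).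
have ben0 : be != 0 by rewrite -sqrf_eq0 beE fmorph_eq0 oppr_eq0.
have be2 (h : galois_group j1) : h (be ^+ 2) = be ^+ 2 by rewrite beE galgrp_fix.
have [||Y [YM Y1 Yi]] := @sign_extend (fun h => sgn be h).
- by move=> g h; rewrite sgnM.
- by exists [:: be] => g _ /(_ be); rewrite mem_head /sgn => -> //; rewrite eqxx.
have [d [de [dn0 deE deP]]] := kummer_square_root galj YM Y1.
have den0 : de != 0 by rewrite -sqrf_eq0 deE fmorph_eq0.
have [_ [x [y xyE]]] : represented (- d) r by apply: rR; rewrite /nonzero /= oppr_eq0.
have [om omE] := sqrtL (j x + de * j y).
have [|g|g|g|c cM [A cA]] := @cup_of_norm _ _ j n2 rho de (j x) (j y) om rhon0 den0 _ omE rho2.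
- by rewrite rhoE xyE deE rmorphD rmorphM rmorphN !rmorphXn /= mulNr.
- by rewrite deE galgrp_fix.
- by rewrite galgrp_fix.
- by rewrite galgrp_fix.
have [] := @norm_of_cup _ _ j1 galj1.1 n2 setT mu be (fun h => c (i1 h))
  (subgroup_setT j1) mun0 ben0.
- by move=> h _; rewrite muE galgrp_fix.
- by move=> h _; exact: be2.
- by move=> g h _ _; rewrite hi1.1 cM deP Yi muP.
- have [|B BP] := continuous_near1 (V := [set g : galois_group j | {in A, forall x, g x = x}]) hi1.
    by apply/galgrp_nbhsP; exists A => g gA z zA; rewrite -gA.
  by exists B => h _ /BP; exact: cA.
move=> p [q [pfix qfix muE']].
have [g|p' _ p'E] := galj1.2 p; first exact: pfix.
have [g|q' _ q'E] := galj1.2 q; first exact: qfix.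
exists p', q'; apply: (fmorph_inj j1).
by rewrite -muE muE' beE -p'E -q'E rmorphD rmorphM !rmorphXn rmorphN mulNr opprK.
Qed.

Section Monomial.
Variable eps : galois_group j -> bool.
Hypothesis epsM : {morph eps : g h / (g * h)%g >-> g (+) h}.

(** om_0^2 and om_1^2 are conjugate over F, permuted through eps.  G then acts on
    the set of the four elements om_b and -om_b, which yields a homomorphism to
    Z/2 wr Z/2; its base components at g are the signs msgn om b g. *)
Definition permuted_squares (om : bool -> L) :=
  forall (g : galois_group j) b, g (om b ^+ 2) = om (eps g (+) b) ^+ 2.

Definition msgn (om : bool -> L) (b : bool) (g : galois_group j) : bool :=
  g (om (eps g (+) b)) != om b.

Lemma msgnE om b (g : galois_group j) : permuted_squares om ->
  g (om b) = (-1) ^+ msgn om (eps g (+) b) g * om (eps g (+) b).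
Proof.
move=> omP; have : g (om b) ^+ 2 == om (eps g (+) b) ^+ 2 by rewrite -gal_exp omP.
rewrite /msgn addbA addbb addFb eqf_sqr.
case: eqP => [->|_ /= /eqP ->]; first by rewrite /= expr0 mul1r.
by rewrite expr1 mulN1r.
Qed.

Lemma msgnM om b g h : permuted_squares om -> (forall b, om b != 0) ->
  msgn om b (g * h)%g = msgn om b g (+) msgn om (eps g (+) b) h.
Proof.
move=> omP om0; apply: (sign_inj n2 (om0 b)).
have := msgnE (eps (g * h)%g (+) b) (g * h)%g omP.
rewrite addbA addbb addFb => <-.
rewrite galgrpM msgnE // epsM.
have -> : eps h (+) (eps g (+) eps h (+) b) = eps g (+) b.
  by case: (eps g); case: (eps h); case: b.
rewrite gal_mul gal_sign msgnE // addbA addbb addFb mulrA -signr_addb.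
by rewrite addbC.
Qed.

Hypothesis eps1 : trivial_near1 setT eps.

(** If the signs of om vanish on G1, then om_0^2 is a norm from every quadratic
    extension of the fixed field of ker eps: the signs of om and be define Phi,
    which lifts to U wr Z/2 over G1 with trivial corner entries, hence over G.
    The corner entry of the first component of the lift is a cochain on ker eps
    with coboundary the cup product of the characters of om_0^2 and be_0^2. *)
Lemma norm_of_trivial_signs om be :
  permuted_squares om -> (forall b, om b != 0) ->
  permuted_squares be -> (forall b, be b != 0) ->
  (forall b h, msgn om b (i1 h) = false) ->
  exists p q, [/\ forall g : galois_group j, eps g = false -> g p = p,
    forall g : galois_group j, eps g = false -> g q = q
    & om false ^+ 2 = p ^+ 2 - be false ^+ 2 * q ^+ 2].
Proof.
move=> omP om0 beP be0 om1.
pose Phi g : wreath false := ((msgn om false g, msgn be false g, false),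
  (msgn om true g, msgn be true g, false), eps g).
pose Psi1 h : wreath true := ((false, msgn be false (i1 h), false),
  (false, msgn be true (i1 h), false), eps (i1 h)).
have [A0 A0P] := eps1.
have near1 (g : galois_group j) :
    {in A0 ++ [:: om false; om true; be false; be true], forall x, g x = x} ->
    Phi g = 1%g.
  move=> gA; have eg : eps g = false.
    by apply: A0P => // x xA; apply: gA; rewrite mem_cat xA.
  have gB x : x \in [:: om false; om true; be false; be true] -> g x = x.
    by move=> xB; apply: gA; rewrite mem_cat xB orbT.
  by rewrite /Phi eg /msgn eg !gB ?inE ?eqxx ?orbT.
have hPhi : continuous_hom Phi.
  apply: galois_hom_continuous near1 => g h.
  rewrite /Phi !msgnM // epsM addbF addbT.
  by rewrite -[RHS]/(wreath_mul _ _) /wreath_mul /heis_mul /=; case: (eps g).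
have hPsi1 : continuous_hom Psi1.
  have [|B BP] := continuous_near1 (V := [set g | Phi g = 1%g]) hi1.
    have := hPhi.2 1%g [set 1%g]; apply; apply/wreath_nbhs.
    by rewrite /= (hom1 hPhi.1).
  apply: (galois_hom_continuous (A := B)) => [g h|g /BP].
    rewrite /Psi1 hi1.1 !msgnM // epsM addbF addbT.
    by rewrite -[RHS]/(wreath_mul _ _) /wreath_mul /heis_mul /=; case: (eps _).
  by rewrite /= /Phi /Psi1 => -[_ -> _ -> ->].
have [||Psi [hPsi abPsi _]] := wreath_lift free0 hi0 hi1 univ hPhi hPsi1.
- by apply: funext => h; rewrite /Psi1 /Phi /= !om1.
- by [].
have PsiE g : Phi g = wreath_forget (Psi g) by rewrite -abPsi.
have e_Psi g : (Psi g).2 = eps g by have := congr1 snd (PsiE g).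
have z_Psi g : (Psi g).1.1.1 = (msgn om false g, msgn be false g).
  by have := congr1 (fun u : wreath false => u.1.1.1) (PsiE g).
pose H := [set g | eps g = false].
have eps11 : eps 1%g = false.
  by have := epsM 1%g 1%g; rewrite mulg1 addbb.
have epsV g : eps (g^-1)%g = eps g.
  have := epsM (g^-1)%g g; rewrite mulVg eps11.
  by case: (eps g); case: (eps _).
have sH : subgroup_set H.
  split=> //; first by move=> g h; rewrite /H /= epsM => -> ->.
  by move=> g; rewrite /H /= epsV.
have sgn_m om' g : H g -> sgn (om' false) g = msgn om' false g.
  by move=> Hg; rewrite /msgn Hg.
apply: (@norm_of_cup _ _ j galj.1 n2 H (om false) (be false) (fun g => (Psi g).1.1.2) sH) => //.
- by move=> g Hg; rewrite omP Hg.
- by move=> g Hg; rewrite beP Hg.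
- move=> g h Hg Hh; rewrite !sgn_m // hPsi.1 -[(Psi g * Psi h)%g]/(wreath_mul _ _).
  by rewrite /wreath_mul /heis_mul /= e_Psi Hg /= !z_Psi.
- have [|B BP] := continuous_near1 (V := [set 1%g]) hPsi; first exact/wreath_nbhs.
  by exists B => g _ /BP ->.
Qed.

End Monomial.

End FreeProduct.

(** * Quadratic extensions *)

Section Quadratic.
Variables (F : fieldType) (a : F) (K : splittingFieldType F) (s : K).
Hypotheses (n2 : 2%:R != 0 :> F) (ha : a != 0) (hna : ~ nonzero_squares F a).
Hypotheses (hs : s ^+ 2 = a%:A) (hK : <<1; s>>%VS = fullv).

Local Notation iota := (in_alg K).

Let iotaM c d : iota (c * d) = iota c * iota d. Proof. exact: rmorphM. Qed.
Let iotaD c d : iota (c + d) = iota c + iota d. Proof. exact: rmorphD. Qed.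
Let iotaB c d : iota (c - d) = iota c - iota d. Proof. exact: rmorphB. Qed.
Let iotaX c n : iota (c ^+ n) = iota c ^+ n. Proof. exact: rmorphXn. Qed.
Let iota_a : iota a = s ^+ 2. Proof. exact/esym. Qed.

Lemma quad_coords (x : K) : exists u v : F, x = iota u + iota v * s.
Proof.
have : x \in <<1; s>>%VS by rewrite hK memvf.
move=> /Fadjoin1_polyP[q ->].
elim/poly_ind: q => [|q c [u [v IH]]].
  by exists 0, 0; rewrite !rmorph0 horner0 mul0r addr0.
exists (a * v + c), u; rewrite rmorphD rmorphM /= map_polyX map_polyC !hornerE IH.
rewrite -[RHS]/(iota (a * v + c) + iota u * s) -[X in _ + X = _]/(iota c).
by rewrite iotaD iotaM iota_a; ring.
Qed.

Lemma quad_gen_notin (u : F) : s <> iota u.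
Proof.
move=> su; apply: hna; exists u.
  apply: contraNneq ha => u0; have /eqP : iota a = 0.
    by rewrite iota_a su u0 rmorph0 expr0n.
  by rewrite fmorph_eq0.
have : iota (u ^+ 2) = iota a by rewrite iota_a su iotaX.
exact: fmorph_inj.
Qed.

Lemma quad_uniq (u v u' v' : F) :
  iota u + iota v * s = iota u' + iota v' * s -> u = u' /\ v = v'.
Proof.
have [-> /addIr/fmorph_inj //|vv'] := eqVneq v v'.
move=> /eqP; rewrite -subr_eq0 opprD addrACA -mulrBl -!iotaB.
rewrite addrC addr_eq0 => /eqP vs; case: (@quad_gen_notin (- (u - u') / (v - v'))).
have vn0 : iota (v - v') != 0 by rewrite fmorph_eq0 subr_eq0.
by apply: (mulfI vn0); rewrite vs fmorph_div rmorphN mulrC divfK.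
Qed.

(** K is the splitting field of the separable polynomial X^2 - a, and its group
    consists of the identity and the automorphism sending s to -s. *)
Lemma galNorm_quad (u v : F) :
  galNorm 1 fullv (iota u + iota v * s) = iota (u ^+ 2 - a * v ^+ 2).
Proof.
have n2K : 2%:R != 0 :> K by rewrite -(rmorph_nat iota) fmorph_eq0.
have sn0 : s != 0 by rewrite -sqrf_eq0 hs -[a%:A]/(iota a) fmorph_eq0.
have sns : s != - s.
  by rewrite -subr_eq0 opprK -mulr2n -mulr_natl mulf_neq0.
have galK : galois 1 {:K}.
  apply/splitting_galoisField; exists ('X^2 - (a%:A)%:P).
  have fac : 'X^2 - (a%:A)%:P = \prod_(z <- [:: s; - s]) ('X - z%:P) :> {poly K}.
    by rewrite !big_cons big_nil mulr1 -hs polyCN rmorphXn; ring.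
  split.
  - by rewrite rpredB ?rpredX ?polyOverX // polyOverC rpredZ ?mem1v.
  - by rewrite fac separable_prod_XsubC /= inE sns.
  - exists [:: s; - s]; first by rewrite fac eqpxx.
    apply/eqP; rewrite eqEsubv subvf /= -[fullv]hK adjoin_cons.
    by rewrite subv_adjoin_seq.
have fiota (f : gal_of {:K}) c : f (iota c) = iota c.
  by rewrite /= linearZZ rmorph1.
have fs (f : gal_of {:K}) : f s = s \/ f s = - s.
  have : f s ^+ 2 == s ^+ 2.
    by rewrite -rmorphXn -iota_a; apply/eqP; exact: fiota.
  by rewrite eqf_sqr => /orP[]/eqP; [left|right].
have fE (f : gal_of {:K}) (x y : F) : f (iota x + iota y * s) = iota x + iota y * f s.
  by rewrite rmorphD rmorphM; congr (_ + _ * _); exact: fiota.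
have fext (f g : gal_of {:K}) : f s = g s -> f = g.
  move=> fg; apply/eqP/gal_eqP => x _; have [x0 [x1 ->]] := quad_coords x.
  by rewrite !fE fg.
have [f fG fsn] : exists2 f, f \in 'Gal({:K} / 1)%g & f s = - s.
  apply: contrapT => nf.
  have : s \in fixedField 'Gal({:K} / 1)%g.
    apply/fixedFieldP => [|g gG]; first exact: memvf.
    by have [//|gs] := fs g; case: nf; exists g.
  rewrite (galois_fixedField _) // => /vlineP[c sc].
  exact: (@quad_gen_notin c).
have id_s : (1%g : gal_of {:K}) s = s by rewrite gal_id.
rewrite /galNorm (bigD1 1%g) ?group1 //= gal_id (bigD1 f) /=; last first.
  by rewrite fG; apply: contraNneq sns => f1; rewrite -fsn f1 id_s.
rewrite big1 => [|g /andP[/andP[_ g1] gf]]; last first.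
  have [gs|gs] := fs g; first by case/eqP: g1; apply: fext; rewrite gs id_s.
  by case/eqP: gf; apply: fext; rewrite gs fsn.
rewrite mulr1 (fE f) fsn -[RHS]/(iota (u ^+ 2 - a * v ^+ 2)).
rewrite iotaB (iotaM a) !iotaX iota_a.
by rewrite -[u%:A]/(iota u) -[v%:A]/(iota v); ring.
Qed.

Variables (L : fieldType) (j : {rmorphism F -> L}) (al : L).
Hypothesis alE : al ^+ 2 = j a.

Lemma quad_embedding : exists kappa : {rmorphism K -> L},
  forall u v, kappa (iota u + iota v * s) = j u + j v * al.
Proof.
pose cu x := cid (quad_coords x); pose cv x := cid (svalP (cu x)).
pose k x := j (sval (cu x)) + j (sval (cv x)) * al.
have kE u v : k (iota u + iota v * s) = j u + j v * al.
  have /quad_uniq[uE vE] := svalP (cv (iota u + iota v * s)).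
  by congr (j _ + j _ * al).
have k1 : zmod_morphism k.
  move=> x y; have [u [v ->]] := quad_coords x; have [u' [v' ->]] := quad_coords y.
  by rewrite opprD addrACA -mulrBl -!iotaB !kE !rmorphB; ring.
have k2 : monoid_morphism k.
  split.
    have -> : 1 = iota 1 + iota 0 * s by rewrite rmorph1 rmorph0 mul0r addr0.
    by rewrite kE rmorph1 rmorph0 mul0r addr0.
  move=> x y; have [u [v ->]] := quad_coords x; have [u' [v' ->]] := quad_coords y.
  have -> : (iota u + iota v * s) * (iota u' + iota v' * s) =
      iota (u * u' + a * (v * v')) + iota (u * v' + v * u') * s.
    by rewrite !iotaD !iotaM iota_a; ring.
  by rewrite !kE !rmorphD !rmorphM -alE; ring.
pose kappa : {rmorphism K -> L} := HB.pack k (GRing.isZmodMorphism.Build _ _ k k1)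
  (GRing.isMonoidMorphism.Build _ _ k k2).
by exists kappa.
Qed.

Lemma quad_norm_neq0 (u v : F) : iota u + iota v * s != 0 -> u ^+ 2 - a * v ^+ 2 != 0.
Proof.
have [->|vn0] := eqVneq v 0.
  by rewrite rmorph0 mul0r addr0 fmorph_eq0 expr0n mulr0 subr0 expf_eq0.
move=> _; apply: contra_notN hna => /eqP/subr0_eq uv.
have aE : a = (u / v) ^+ 2 by rewrite expr_div_n uv mulfK // expf_neq0.
exists (u / v) => //.
by apply: contraNneq ha => w0; rewrite aE w0 expr0n.
Qed.

End Quadratic.

(** * The preimage of the radical under the norm *)

(** With r = x^2 + d y^2, the norm of r is
    (N x - d N y)^2 + d (x y' + x' y)^2, where ' is conjugation. *)
Lemma norm_radical (F : fieldType) (a : F) (K : splittingFieldType F) (s : K) (u v : F) :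
  2%:R != 0 :> F -> a != 0 -> ~ nonzero_squares F a ->
  s ^+ 2 = a%:A -> <<1; s>>%VS = fullv ->
  kaplansky_radical K (in_alg K u + in_alg K v * s) ->
  kaplansky_radical F (u ^+ 2 - a * v ^+ 2).
Proof.
move=> n2 an0 hna hs hK rR d dn0.
pose iota := in_alg K.
have iotaM c c' : iota (c * c') = iota c * iota c' := rmorphM iota c c'.
have iotaD c c' : iota (c + c') = iota c + iota c' := rmorphD iota c c'.
have Nn0 : u ^+ 2 - a * v ^+ 2 != 0.
  by apply: (quad_norm_neq0 an0 hna (s := s)); have [|] := rR 1; first exact: oner_neq0.
split=> //; have [_ [x [y]]] : represented (iota d) (iota u + iota v * s).
  by apply: rR; rewrite /nonzero /= fmorph_eq0.
have [x0 [x1 ->]] := quad_coords hs hK x; have [y0 [y1 ->]] := quad_coords hs hK y.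
have -> : (iota x0 + iota x1 * s) ^+ 2 + iota d * (iota y0 + iota y1 * s) ^+ 2 =
   iota (x0 * x0 + a * (x1 * x1) + d * (y0 * y0 + a * (y1 * y1))) +
   iota (x0 * x1 + x0 * x1 + d * (y0 * y1 + y0 * y1)) * s.
  have iota_a : iota a = s ^+ 2 by [].
  by rewrite !(iotaM, iotaD) iota_a; ring.
move=> /(quad_uniq an0 hna hs)[-> ->].
exists (x0 ^+ 2 - a * x1 ^+ 2 - d * (y0 ^+ 2 - a * y1 ^+ 2)).
by exists (2%:R * (x0 * y0 - a * (x1 * y1))); ring.
Qed.

Section Main.
Variables (F F0 F1 L : fieldType).
Variables (j : {rmorphism F -> L}) (j0 : {rmorphism F0 -> L}) (j1 : {rmorphism F1 -> L}).
Hypotheses (n2 : 2%:R != 0 :> F) (sqrtL : forall b : L, exists c, c ^+ 2 = b).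
Hypotheses (galj : galois_extension j) (galj1 : galois_extension j1).
Hypothesis hprod : free_pro2_product (galois_group j0) (galois_group j1) (galois_group j).
Hypotheses (free0 : free_pro2 (galois_group j0))
  (hrad : kaplansky_radical F1 = nonzero_squares F1).
Variables (a : F) (K : splittingFieldType F) (s : K).
Hypotheses (an0 : a != 0) (hna : ~ nonzero_squares F a).
Hypotheses (hs : s ^+ 2 = a%:A) (hK : <<1; s>>%VS = fullv).

Let n2L : 2%:R != 0 :> L. Proof. by rewrite -(rmorph_nat j) fmorph_eq0. Qed.

Variable al : L.
Hypothesis alE : al ^+ 2 = j a.

Let al0 : al != 0. Proof. by rewrite -sqrf_eq0 alE fmorph_eq0. Qed.
Let eps (g : galois_group j) : bool := sgn al g.
Let al2 (g : galois_group j) : g (al ^+ 2) = al ^+ 2.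
Proof. by rewrite alE galgrp_fix. Qed.

Let epsM : {morph eps : g h / (g * h)%g >-> g (+) h}.
Proof. by move=> g h; rewrite /eps sgnM. Qed.

Let eps1 : trivial_near1 setT eps.
Proof.
by exists [:: al] => g _ /(_ al); rewrite mem_head /eps /sgn => -> //; rewrite eqxx.
Qed.

Variable kappa : {rmorphism K -> L}.
Hypothesis kappaE : forall u v : F, kappa (in_alg K u + in_alg K v * s) = j u + j v * al.

Lemma eps_nontrivial : exists tau, eps tau.
Proof.
apply: contrapT => ne; have [g|b _ bE] := galj.2 al.
  by apply/eqP/negPn/negP => gal; apply: ne; exists g.
apply: hna; exists b; last by apply: (fmorph_inj j); rewrite rmorphXn bE.
by rewrite /nonzero /= -(fmorph_eq0 j) bE.
Qed.

(** For tau outside ker eps, the coordinates of x are (x + tau x) / 2 and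
    (x - tau x) / (2 al). *)
Lemma fixed_by_ker (x : L) :
  (forall g, eps g = false -> g x = x) -> exists y, kappa y = x.
Proof.
move=> xfix; have [tau et] := eps_nontrivial.
have fixG y : (forall g, eps g = false -> g y = y) -> tau y = y -> range j y.
  move=> yfix ty; apply: galj.2 => g.
  case eg: (eps g); last exact: yfix.
  have -> : g = (tau * (tau^-1 * g))%g by rewrite mulKVg.
  rewrite galgrpM yfix //; have := epsM tau (tau^-1 * g)%g; rewrite mulKVg eg et.
  by case: (eps _).
have tx g : eps g = false -> g (tau x) = tau x.
  move=> eg; have -> : (g (tau x) = tau ((tau^-1 * (g * tau))%g x)).
    by rewrite -!galgrpM mulKVg.
  congr (tau _); apply: xfix.
  have := epsM tau (tau^-1 * (g * tau))%g; rewrite mulKVg epsM eg et.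
  by case: (eps _).
have ttx : tau (tau x) = x by rewrite -galgrpM xfix // epsM et.
have gal_al g : eps g = false -> g al = al.
  by move=> eg; rewrite (sgnE (al2 g)) -/(eps g) eg mul1r.
have tal : tau al = - al by rewrite (sgnE (al2 tau)) -/(eps tau) et mulN1r.
have [||u _ uE] := fixG ((x + tau x) / 2%:R).
- by move=> g eg; rewrite gal_div gal_add gal_nat xfix // tx.
- by rewrite gal_div gal_add gal_nat ttx addrC.
have [||v _ vE] := fixG ((x - tau x) / (2%:R * al)).
- by move=> g eg; rewrite gal_div gal_sub gal_mul gal_nat xfix // tx // gal_al.
- by rewrite gal_div gal_sub gal_mul gal_nat ttx tal mulrN invrN mulrN -mulNr opprB.
exists (in_alg K u + in_alg K v * s).
by rewrite kappaE uE vE; field; rewrite n2L al0.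
Qed.

Lemma conjugate_roots (u v : F) : in_alg K u + in_alg K v * s != 0 ->
  exists om : bool -> L,
    [/\ forall b, om b ^+ 2 = j u + (-1) ^+ b * (j v * al),
        permuted_squares eps om & forall b, om b != 0].
Proof.
move=> x0.
pose om b := sval (cid (sqrtL (j u + (-1) ^+ b * (j v * al)))).
have omE b : om b ^+ 2 = j u + (-1) ^+ b * (j v * al).
  exact: svalP (cid (sqrtL _)).
have perm : permuted_squares eps om.
  move=> g b; rewrite !omE gal_add !gal_mul gal_sign !galgrp_fix (sgnE (al2 g)).
  by rewrite signr_addb -/(eps g); ring.
exists om; split=> // b; apply: contraNneq x0 => omb0.
have : kappa (in_alg K u + in_alg K ((-1) ^+ b * v) * s) = 0.
  rewrite kappaE rmorphM rmorph_sign -mulrA -omE omb0 expr0n //.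
move=> /eqP; rewrite fmorph_eq0 => /eqP x0.
have [|-> /eqP] := @quad_uniq _ _ _ _ an0 hna hs u ((-1) ^+ b * v) 0 0.
  by rewrite x0 rmorph0 mul0r addr0.
by rewrite mulf_eq0 signr_eq0 => /eqP ->; rewrite rmorph0 mul0r addr0.
Qed.

Lemma trivial_near1_msgn (om : bool -> L) b : trivial_near1 setT (msgn eps om b).
Proof.
have [A AP] := eps1; exists (om b :: A) => g _ gA.
have eg : eps g = false by apply: AP => // x xA; apply: gA; rewrite in_cons xA orbT.
by rewrite /msgn eg gA ?eqxx // mem_head.
Qed.

(** The signs of the roots om_0, om_1 of the conjugates of z agree on G1, as
    om_0 om_1 is a square root of r.  There they form a character; the element c
    of F whose character extends it makes the signs of c z trivial on G1. *)
Lemma norm_radical_twist (z : K) (r : F) : z != 0 -> kaplansky_radical F r ->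
  galNorm 1 fullv z = in_alg K r ->
  exists2 c, c != 0 & kaplansky_radical K (in_alg K c * z).
Proof.
have [_ _ _ [i0 [i1 [hi0 hi1 univ]]]] := hprod.
have [u [v ->]] := quad_coords hs hK z.
move=> z0 rR; rewrite (galNorm_quad n2 an0 hna hs hK) => /fmorph_inj rE.
have [om [omE omP om0]] := conjugate_roots z0.
pose rho := om false * om true.
have rhoE : rho ^+ 2 = j r.
  by rewrite exprMn !omE -rE rmorphB (rmorphM j a) !rmorphXn -alE; ring.
have rho_sgn := radical_sgn n2L sqrtL galj galj1 hi1 univ hrad rR rhoE.
have same h : msgn eps om true (i1 h) = msgn eps om false (i1 h).
  have rho0 : rho != 0 by rewrite mulf_neq0.
  have : (i1 h) rho = (-1) ^+ (msgn eps om false (i1 h) (+) msgn eps om true (i1 h)) * rho.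
    rewrite /rho gal_mul !(msgnE _ _ omP) signr_addb addbF addbT.
    by case: (eps (i1 h)) => /=; ring.
  have /negbFE/eqP -> := rho_sgn h; rewrite -{1}[rho]mul1r -[X in X * _](expr0 (-1)).
  move=> /(sign_inj (b := false) n2L rho0).
  by case: (msgn _ _ true _); case: (msgn _ _ false _).
have [||X [XM X1 Xi]] := sign_extend (xi := fun h => msgn eps om false (i1 h)) univ.
- move=> g h; rewrite hi1.1 (msgnM n2L epsM _ _ _ omP om0).
  by case: (eps (i1 g)); rewrite ?same.
- have [A AP] := trivial_near1_msgn om false.
  have [|B BP] := continuous_near1 (V := [set g : galois_group j | {in A, forall x, g x = x}]) hi1.
    by apply/galgrp_nbhsP; exists A => g gA x xA; rewrite -gA.
  by exists B => h _ /BP; exact: AP.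
have [c [ga [c0 gaE gaP]]] := kummer_square_root n2L galj XM X1.
exists c => // b b0.
have ga0 : ga != 0 by rewrite -sqrf_eq0 gaE fmorph_eq0.
pose om' i := ga * om i.
have om'P : permuted_squares eps om'.
  by move=> g i; rewrite !exprMn gal_mul omP gaE galgrp_fix.
have om'0 i : om' i != 0 by rewrite mulf_neq0.
have om'1 i h : msgn eps om' i (i1 h) = false.
  rewrite /msgn /om' gal_mul (msgnE _ _ omP) addbA addbb addFb.
  rewrite (sgnE (g := i1 h)) ?gaE ?galgrp_fix // gaP Xi.
  have -> : msgn eps om i (i1 h) = msgn eps om false (i1 h) by case: i; rewrite ?same.
  by rewrite mulrACA -signr_addb addbb mul1r eqxx.
have [u' [v' bE]] := quad_coords hs hK (- b).
have [|be [beE beP be0]] := @conjugate_roots u' v'; first by rewrite -bE oppr_eq0.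
have [p [q [pfix qfix]]] :=
  norm_of_trivial_signs n2L galj hi0 hi1 univ free0 epsM eps1 om'P om'0 beP be0 om'1.
have [p' <-] := fixed_by_ker pfix; have [q' <-] := fixed_by_ker qfix.
rewrite exprMn gaE omE beE expr0 !mul1r -!kappaE -bE => eqL.
split; first by rewrite mulf_neq0 ?fmorph_eq0.
exists p', q'; apply: (fmorph_inj kappa).
have -> : in_alg K c * (in_alg K u + in_alg K v * s) =
   (in_alg K c + in_alg K 0 * s) * (in_alg K u + in_alg K v * s).
  by rewrite rmorph0 mul0r addr0.
rewrite rmorphM kappaE rmorph0 mul0r addr0 eqL.
by rewrite rmorphD rmorphM rmorphN !rmorphXn mulNr opprK.
Qed.

End Main.

Theorem theorem9
  (F : fieldType) (charF : 2%N \notin [pchar F])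
  (* F2 is F(2), inside the separable closure Fs *)
  (Fs F2 : fieldType) (e : {rmorphism F -> Fs}) (he : separable_closure e)
  (j : {rmorphism F -> F2}) (k : {rmorphism F2 -> Fs})
  (hF2 : maximal_two_extension e j k)
  (* intermediate fields F0, F1 of F(2) / F *)
  (F0 F1 : fieldType)
  (i0 : {rmorphism F -> F0}) (j0 : {rmorphism F0 -> F2}) (h0 : j0 \o i0 =1 j)
  (i1 : {rmorphism F -> F1}) (j1 : {rmorphism F1 -> F2}) (h1 : j1 \o i1 =1 j)
  (hprod : free_pro2_product (galois_group j0) (galois_group j1) (galois_group j))
  (hfree : free_pro2 (galois_group j0))
  (hrad : kaplansky_radical F1 = nonzero_squares F1)
  (* K = F(sqrt a) *)
  (a : F) (ha : a != 0) (hna : ~ nonzero_squares F a)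
  (K : splittingFieldType F) (s : K) (hs : s ^+ 2 = a%:A)
  (hK : <<1; s>>%VS = fullv) :
  [set z : K | z != 0 /\
     exists2 r : F, kaplansky_radical F r & galNorm 1 fullv z = r%:A]
  = [set c%:A * r | c in nonzero F & r in kaplansky_radical K].
Proof.
have n2 : 2%:R != 0 :> F by apply: contra charF => n2; rewrite inE /=.
have [kj hj _] := hF2.
have sqrtL b : exists c : F2, c ^+ 2 = b.
  exact: maximal_two_extension_sqrt charF he kj hj b hF2.
have galj1 : galois_extension j1.
  split=> x; last exact: intermediate_fixed_field he kj hj.1 h1.
  have [p pn0 rp] := hj.1.1 x; exists (map_poly i1 p); first by rewrite map_poly_eq0.
  by rewrite -map_poly_comp (eq_map_poly h1).
have [al alE] := sqrtL (j a).
have [kappa kappaE] := quad_embedding ha hna hs hK alE.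
apply/seteqP; split=> [z [z0 [r rR Nz]]|_ [c c0 [r rR <-]]].
  have [c c0 cR] := norm_radical_twist n2 sqrtL hj.1 galj1 hprod hfree hrad ha hna hs hK
    alE kappaE z0 rR Nz.
  exists c^-1; first by rewrite /nonzero /= invr_eq0.
  exists (c%:A * z) => //.
  have c0' : in_alg K c != 0 by rewrite fmorph_eq0.
  by rewrite -[c^-1%:A]/(in_alg K c^-1) -[c%:A]/(in_alg K c) fmorphV mulKf.
have rn0 : r != 0 by have [|] := rR 1; first exact: oner_neq0.
have [u [v rE]] := quad_coords hs hK r.
have NR : kaplansky_radical F (u ^+ 2 - a * v ^+ 2).
  by apply: norm_radical n2 ha hna hs hK _; rewrite -rE.
have cn0 : in_alg K c != 0 by rewrite fmorph_eq0.
split; first by rewrite mulf_neq0.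
exists (c ^+ 2 * (u ^+ 2 - a * v ^+ 2)).
  move=> d dn0; have [Nn0 [x [y xy]]] := NR d dn0.
  split; first by rewrite mulf_neq0 ?expf_neq0.
  by exists (c * x), (c * y); rewrite xy; ring.
have -> : c%:A * r = in_alg K (c * u) + in_alg K (c * v) * s.
  by rewrite rE !(rmorphM (in_alg K)) /=; ring.
rewrite (galNorm_quad n2 ha hna hs hK) -[RHS]/(in_alg K _); congr (in_alg K _).
by ring.
Qed.
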